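(* Let $F$ and $H$ be graphs with $\chi(F)=k+1$ and $\chi(H)<\chi(F)$. If $H$ is weakly asymptotically $F$-Turán-good and weakly $K_{k+1}$-Turán-stable, then $H$ is weakly $F$-Turán-stable. Furthermore, if $H$ is asymptotically $F$-Turán-good and $K_{k+1}$-Turán-stable, then $H$ is $F$-Turán-stable.
   Context: All graphs are finite and simple. $\mathcal{N}(H,G)$ is the number of (not necessarily induced) subgraphs of $G$ isomorphic to $H$ (copies of $H$). A graph is $F$-free if it contains no copy of $F$ as a (not necessarily induced) subgraph. $\mathrm{ex}(n,H,F)$ is the maximum of $\mathcal{N}(H,G)$ over all $n$-vertex $F$-free graphs $G$. $T(n,k)$ denotes the complete $k$-partite $n$-vertex graph with each part of order $\lfloor n/k\rfloor$ or $\lceil n/k\rceil$. Asymptotics are as $n\to\infty$ with $H,F$ fixed. Let $\chi(F)=k+1$. $H$ is asymptotically $F$-Turán-good if $\mathrm{ex}(n,H,F)=(1+o(1))\mathcal{N}(H,T(n,k))$, and weakly asymptotically $F$-Turán-good if $\mathrm{ex}(n,H,F)=(1+o(1))\mathcal{N}(H,T)$ for some complete $k$-partite $n$-vertex graph $T$ (depending on $n$). Let $\chi(H)<\chi(F)=k+1$. $H$ is $F$-Turán-stable if: whenever $G$ is an $n$-vertex $F$-free graph with $\mathcal{N}(H,G)\ge \mathrm{ex}(n,H,F)-o(n^{|V(H)|})$, then $G$ can be obtained from $T(n,k)$ by adding and removing $o(n^2)$ edges. That is, for every $\varepsilon>0$ there are $\delta>0$ and $n_0$ such that every $F$-free graph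 $G$ on $n\ge n_0$ vertices with $\mathcal{N}(H,G)\ge \mathrm{ex}(n,H,F)-\delta n^{|V(H)|}$ can be obtained from (a copy on $V(G)$ of) $T(n,k)$ by adding and removing at most $\varepsilon n^2$ edges. $H$ is weakly $F$-Turán-stable if the same holds with ''some complete $k$-partite graph on $V(G)$'' in place of $T(n,k)$. The ($K_{k+1}$)-versions are these definitions applied with $F$ replaced by $K_{k+1}$, which also has chromatic number $k+1$. *)

(* Defs.v *)
From HB Require Import structures.
From mathcomp Require Import all_boot all_order ssralg ssrnum.
From mathcomp Require Import functions reals topology normedtype landau.

Set Implicit Arguments.
Unset Strict Implicit.
Unset Printing Implicit Defensive.

Import Order.TTheory GRing.Theory Num.Theory.
Import numFieldNormedType.Exports.

(* Simple graphs with vertex set T, given by their set of edges. *)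
Record sgraph (T : finType) := SGraph {
  edges : {set {set T}};
  _ : edges \subset [set e : {set T} | #|e| == 2]
}.

HB.instance Definition _ (T : finType) := [isSub for @edges T].
HB.instance Definition _ (T : finType) := [Finite of sgraph T by <:].

Section Graphs.
Variable T : finType.
Implicit Type G : sgraph T.

Definition adj G : rel T := fun x y => [set x; y] \in edges G.

Definition colorable G (k : nat) : bool :=
  [exists c : {ffun T -> 'I_k}, [forall x, forall y, adj G x y ==> (c x != c y)]].

Lemma adj_irr G x : adj G x x = false.
Proof.
case: G => E sE; apply/negP; rewrite /adj /= => /(subsetP sE).
by rewrite inE setUid cards1.
Qed.

Lemma colorable_card G : exists k, colorable G k.
Proof.
exists #|T|; apply/existsP; exists [ffun x => enum_rank x].
apply/forallP => x; apply/forallP => y; apply/implyP; rewrite !ffunE => xy.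
by apply/eqP => /enum_rank_inj exy; move: xy; rewrite exy adj_irr.
Qed.

Definition chi G : nat := ex_minn (colorable_card G).

(* Parts are allowed to be empty, as is unavoidable for T(n, k) when n < k. *)
Definition complete_kpartite (k : nat) G : Prop :=
  exists c : T -> 'I_k, forall x y, adj G x y = (c x != c y).

(* G is (a copy on T of) the Turan graph T(#|T|, k); the second size is the
   ceiling of #|T| / k. *)
Definition is_turan (k : nat) G : Prop :=
  exists c : T -> 'I_k, (forall x y, adj G x y = (c x != c y)) /\
    (forall j : 'I_k,
       #|[set x | c x == j]| = #|T| %/ k \/
       #|[set x | c x == j]| = (#|T| + k.-1) %/ k).

Definition edge_dist G G' : nat :=
  #|(edges G :\: edges G') :|: (edges G' :\: edges G)|.

End Graphs.

Fact complete_subproof n :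
  [set e : {set 'I_n} | #|e| == 2] \subset [set e : {set 'I_n} | #|e| == 2].
Proof. exact: subxx. Qed.

Definition complete (n : nat) : sgraph 'I_n := SGraph (complete_subproof n).

Section Copies.
Variables (S T : finType).
Implicit Types (H : sgraph S) (G : sgraph T).

(* A subgraph of G is represented by its pair (vertex set, edge set). *)
Definition subgraph_of G (K : {set T} * {set {set T}}) : bool :=
  (K.2 \subset edges G) && [forall e in K.2, e \subset K.1].

Definition isomorphic_to H (K : {set T} * {set {set T}}) : bool :=
  [exists f : {ffun S -> T},
     [&& injectiveb f,
         K.1 == [set f x | x : S] &
         K.2 == [set [set f x | x in e] | e : {set S} in edges H]]].

Definition ncopies H G : nat :=
  #|[set K : {set T} * {set {set T}} | subgraph_of G K && isomorphic_to H K]|.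

Definition free H G : bool := ncopies H G == 0.

End Copies.

Section Turan.
Variables (VF VH : finType).

(* This is 0 when there is no F-free graph on n vertices, which can only happen
   if F has no edges. *)
Definition gen_ex (n : nat) (H : sgraph VH) (F : sgraph VF) : nat :=
  \max_(G : sgraph 'I_n | free F G) ncopies H G.

Local Open Scope classical_set_scope.
Local Open Scope ring_scope.

Variable R : realType.

Definition asymp_good_wrt (P : forall n, sgraph 'I_n -> Prop)
    (F : sgraph VF) (H : sgraph VH) : Prop :=
  exists T : forall n, sgraph 'I_n, (forall n, P n (T n)) /\
    (fun n : nat => (gen_ex n H F)%:R : R) ~_\oo
      (fun n : nat => (ncopies H (T n))%:R : R).

Definition stable_wrt (P : forall n, sgraph 'I_n -> Prop)
    (F : sgraph VF) (H : sgraph VH) : Prop :=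
  forall eps : R, 0 < eps ->
  exists (delta : R) (n0 : nat), 0 < delta /\
    forall (n : nat) (G : sgraph 'I_n), (n0 <= n)%N -> free F G ->
      (ncopies H G)%:R >= (gen_ex n H F)%:R - delta * n%:R ^+ #|VH| ->
      exists T : sgraph 'I_n, P n T /\ (edge_dist G T)%:R <= eps * n%:R ^+ 2.

(* In the next four notions k = (chi F).-1, i.e. chi F = k + 1. *)

Definition asymp_turan_good (F : sgraph VF) (H : sgraph VH) : Prop :=
  asymp_good_wrt (fun n => @is_turan 'I_n (chi F).-1) F H.

Definition weakly_asymp_turan_good (F : sgraph VF) (H : sgraph VH) : Prop :=
  asymp_good_wrt (fun n => @complete_kpartite 'I_n (chi F).-1) F H.

Definition turan_stable (F : sgraph VF) (H : sgraph VH) : Prop :=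
  stable_wrt (fun n => @is_turan 'I_n (chi F).-1) F H.

Definition weakly_turan_stable (F : sgraph VF) (H : sgraph VH) : Prop :=
  stable_wrt (fun n => @complete_kpartite 'I_n (chi F).-1) F H.

End Turan.

(* Main.v *)
Require Import Defs.
From mathcomp Require Import all_boot all_order ssralg ssrnum archimedean.
From mathcomp Require Import reals.
From mathcomp Require Import ring lra.

Set Implicit Arguments.
Unset Strict Implicit.
Unset Printing Implicit Defensive.

Import Order.TTheory GRing.Theory Num.Theory.

(** By an averaging (supersaturation) argument an F-free graph G on n vertices has
o(n^(k+1)) copies of K_(k+1).  Sample m vertices of G at random with
repetitions, for a large constant m.  Most samples are K_(k+1)-free, and the
expected number of copies of H in a sample is governed by the homomorphism
density of H in G.  This density is nearly as large as the K_(k+1)-free extremal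
density on m vertices: by K_(k+1)-stability the latter is nearly attained by
a complete k-partite graph on m vertices, whose blow-ups to n vertices are
F-free.  Hence most samples are nearly extremal, and so, by stability, close to
complete k-partite (or Turan) graphs.  In particular G has few triples (v, x, y)
in which x is a non-neighbour of v and y distinguishes v from x; together with
the scarcity of K_(k+1) this lets one choose greedily at most k
non-neighbourhoods that nearly partition the vertices and show that G is close
to a complete k-partite graph.  In the Turan case the samples also determine the
edge density of G, which forces the parts to be nearly balanced. *)

(** * Homomorphisms and copies *)

Section Basics.
Variable T : finType.
Implicit Types G : sgraph T.

Lemma adjC G x y : adj G x y = adj G y x.
Proof. by rewrite /adj setUC. Qed.

Lemma edgeP G (e : {set T}) :
  reflect (exists x y, adj G x y /\ e = [set x; y]) (e \in edges G).
Proof.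
apply: (iffP idP) => [eG|[x [y [xy ->]]]] //.
have /subsetP/(_ e eG) : edges G \subset [set e : {set T} | #|e| == 2] by case: (G).
rewrite inE; by case/cards2P=> x [y [_ def_e]]; exists x, y; rewrite /adj -def_e.
Qed.

Lemma adj_neq G x y : adj G x y -> x != y.
Proof. by move=> xy; apply/eqP => exy; rewrite exy adj_irr in xy. Qed.

Lemma graph_of_subproof (r : rel T) :
  [set [set p.1; p.2] | p in [set p : T * T | [&& p.1 != p.2, r p.1 p.2 & r p.2 p.1]]]
    \subset [set e : {set T} | #|e| == 2].
Proof.
apply/subsetP=> e /imsetP[[x y]]; rewrite !inE /= => /andP[xy _] ->.
by rewrite cards2 xy.
Qed.

(** Loops and one-sided pairs are discarded, so that every relation yields a simple graph. *)
Definition graph_of (r : rel T) : sgraph T := SGraph (graph_of_subproof r).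

Lemma set2_inj (x y z t : T) : [set x; y] = [set z; t] -> (x = z /\ y = t) \/ (x = t /\ y = z).
Proof.
move=> E.
have hx : x \in [set z; t] by rewrite -E set21.
have hy : y \in [set z; t] by rewrite -E set22.
have hz : z \in [set x; y] by rewrite E set21.
have ht : t \in [set x; y] by rewrite E set22.
move: hx; rewrite in_set2 => /orP[]/eqP xE; [left|right]; split=> //; move: hy ht hz; rewrite !in_set2 xE.
  by case/orP=> /eqP-> //; rewrite orbb eq_sym => /eqP.
by case/orP=> /eqP-> // _; rewrite orbb => /eqP.
Qed.

Lemma adj_graph_of (r : rel T) x y : symmetric r -> adj (graph_of r) x y = (x != y) && r x y.
Proof.
move=> rC; apply/imsetP/andP => [[[z t]]|[xy rxy]]; last first.
  by exists (x, y); rewrite //= inE /= xy rxy rC rxy.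
rewrite inE /= => /and3P[zt r1 r2] /set2_inj[[-> ->]|[-> ->]] //.
by rewrite eq_sym.
Qed.

Definition empty_graph := graph_of (fun _ _ : T => false).

Lemma adj_empty x y : adj empty_graph x y = false.
Proof. by rewrite adj_graph_of // andbF. Qed.

Definition partite k (c : T -> 'I_k) := graph_of (fun x y => c x != c y).

Lemma adj_partite k (c : T -> 'I_k) x y : adj (partite c) x y = (c x != c y).
Proof.
rewrite adj_graph_of; last by move=> u v; rewrite eq_sym.
by case: eqP => [->|_] //=; rewrite eqxx.
Qed.

(** An ordered-pair substitute for [edge_dist], equivalent to it up to a constant and suited to
    counting maps. *)
Definition diff_pairs G G' := [set p : T * T | adj G p.1 p.2 != adj G' p.1 p.2].

Lemma edge_dist_le G G' : edge_dist G G' <= #|diff_pairs G G'|.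
Proof.
apply: leq_trans (leq_imset_card (fun p => [set p.1; p.2]) _).
apply/subset_leq_card/subsetP => e; rewrite !inE => H.
have [x [y [def_e neq]]] : exists x y, e = [set x; y] /\ adj G x y != adj G' x y.
  case/orP: H => /andP[N /edgeP[x [y [xy def_e]]]]; exists x, y; split=> //.
    by rewrite xy; move: N; rewrite def_e -/(adj _ _ _) => /negbTE->.
  by rewrite xy; move: N; rewrite def_e -/(adj _ _ _) => /negbTE->.
by apply/imsetP; exists (x, y); rewrite ?inE.
Qed.

(** Each differing pair lies in the square of some differing edge, and such a square has 4
    elements. *)
Lemma diff_pairs_le G G' : #|diff_pairs G G'| <= 4 * edge_dist G G'.
Proof.
rewrite /edge_dist; set E := _ :|: _.
rewrite mulnC -sum_nat_const.
have sub: diff_pairs G G' \subset \bigcup_(e in E) setX e e.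
  apply/subsetP=> [[x y]]; rewrite inE /= => D.
  apply/bigcupP; exists [set x; y]; last by rewrite !inE !eqxx orbT.
  by move: D; rewrite !inE /adj; case: (_ \in _); case: (_ \in _).
apply: leq_trans (subset_leq_card sub) _.
have: forall e, e \in E -> #|e| = 2.
  by move=> e; rewrite !inE => /orP[] /andP[_ /edgeP[x [y [/adj_neq xy ->]]]]; rewrite cards2 xy.
move: (E) => A cA.
apply: leq_trans (_ : \sum_(e in A) #|setX e e| <= _); last first.
  by apply: leq_sum => e /cA ce; rewrite cardsX ce.
elim/big_rec2: _ => [|e m B _ IH]; first by rewrite cards0.
by apply: leq_trans (leq_card_setU _ _) _; rewrite leq_add2l.
Qed.

End Basics.

(** * Pullbacks of graphs and homomorphisms *)

Section Pull.
Variables S T : finType.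

(** Two uses: for a random map [s] this is the graph induced by a sample with repetitions, equal
    vertices becoming non-adjacent twins; for a small graph G on T and a large S it is a blow-up of
    G. *)
Definition pull (s : S -> T) (G : sgraph T) : sgraph S :=
  graph_of (fun x y => adj G (s x) (s y)).

Lemma adj_pull s G x y : adj (pull s G) x y = adj G (s x) (s y).
Proof.
rewrite adj_graph_of => [|u v]; last exact: adjC.
by case: eqP => [->|_] //=; rewrite adj_irr.
Qed.

Lemma complete_kpartite_pull k s G : complete_kpartite k G -> complete_kpartite k (pull s G).
Proof. by case=> c cG; exists (c \o s) => x y; rewrite adj_pull cG. Qed.

Variables (H : sgraph S) (G : sgraph T).

Definition is_hom (f : {ffun S -> T}) : bool :=
  [forall x, forall y, adj H x y ==> adj G (f x) (f y)].

Lemma is_homP (f : {ffun S -> T}) :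
  reflect (forall x y, adj H x y -> adj G (f x) (f y)) (is_hom f).
Proof.
apply: (iffP forallP) => [h x y|h x]; first by move/forallP: (h x) => /(_ y)/implyP.
by apply/forallP=> y; apply/implyP; exact: h.
Qed.

Definition homs := [set f | is_hom f].
Definition injhoms := [set f : {ffun S -> T} | injectiveb f && is_hom f].

Definition copy_of (f : {ffun S -> T}) : {set T} * {set {set T}} :=
  ([set f x | x : S], [set [set f x | x in e] | e : {set S} in edges H]).

Lemma imset_set2 (f : S -> T) x y : [set f z | z in [set x; y]] = [set f x; f y].
Proof. by rewrite imsetU !imset_set1. Qed.

Lemma copy_of_subgraph f : is_hom f = subgraph_of G (copy_of f).
Proof.
apply/is_homP/andP => [h|[/subsetP h _] x y xy].
  split; first apply/subsetP.
    by move=> _ /imsetP[e /edgeP[x [y [xy ->]]] ->]; rewrite imset_set2; apply: h.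
  by apply/forall_inP => _ /imsetP[e _ ->]; apply: imsetS; apply/subsetP.
by apply: h; rewrite -imset_set2; apply/imsetP; exists [set x; y].
Qed.

Lemma copies_copy_of K :
  (K \in [set K | subgraph_of G K && isomorphic_to H K]) =
  [exists f, (f \in injhoms) && (copy_of f == K)].
Proof.
rewrite inE; apply/andP/existsP => [[sK /existsP[f /and3P[fi /eqP e1 /eqP e2]]]|[f]].
  exists f; have eK : copy_of f = K by rewrite /copy_of -e1 -e2 -surjective_pairing.
  by rewrite inE fi eK eqxx andbT copy_of_subgraph eK.
rewrite inE => /andP[/andP[fi fh] /eqP <-]; rewrite -copy_of_subgraph; split=> //.
by apply/existsP; exists f; rewrite fi !eqxx.
Qed.

End Pull.

(** * Copies as classes of injective homomorphisms *)

Section Aut.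
Variables S T : finType.
Variables (H : sgraph S) (G : sgraph T).

(** The automorphisms of H, described as a fibre of [copy_of] so that they compare directly with the
    other fibres. *)
Definition auts := [set s : {ffun S -> S} | injectiveb s & copy_of H s == copy_of H [ffun x => x]].

Lemma copy_of_comp (f : {ffun S -> T}) (s : {ffun S -> S}) :
  copy_of H [ffun x => f (s x)] = ([set f x | x in (copy_of H s).1],
     [set [set f x | x in e] | e : {set S} in (copy_of H s).2]).
Proof.
rewrite /copy_of /=; congr (_, _).
  by rewrite -imset_comp; apply: eq_imset => x; rewrite ffunE.
rewrite -imset_comp; apply: eq_imset => e /=.
by rewrite -imset_comp; apply: eq_imset => x; rewrite ffunE.
Qed.

Lemma copy_of_id : copy_of H [ffun x => x] = ([set: S], edges H).
Proof.
have fid (e : {set S}) : [set [ffun x => x] x | x in e] = e.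
  by rewrite -[RHS]imset_id; apply: eq_imset => x; rewrite ffunE.
rewrite /copy_of; congr (_, _).
  by apply/setP=> z; rewrite inE; apply/imsetP; exists z; rewrite ?ffunE.
by rewrite -[RHS]imset_id; apply: eq_imset => e; exact: fid.
Qed.

(** An injection with the same image copy as [f0] factors uniquely as [f0] after a permutation of S,
    and this permutation preserves the edges of H. *)
Lemma card_copy_fiber (f0 : {ffun S -> T}) : injective f0 ->
  #|[set f : {ffun S -> T} | injectiveb f && (copy_of H f == copy_of H f0)]| = #|auts|.
Proof.
move=> f0i.
pose g (s : {ffun S -> S}) := [ffun x => f0 (s x)] : {ffun S -> T}.
have gi : injective g.
  by move=> s s' /ffunP E; apply/ffunP => x; apply: f0i; move: (E x); rewrite !ffunE.
rewrite -(card_imset _ gi); apply: eq_card => f; rewrite inE.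
apply/andP/imsetP => [[/injectiveP fi /eqP E]|[s]]; last first.
  rewrite inE => /andP[/injectiveP si /eqP E] ->; split.
    by apply/injectiveP => x y; rewrite !ffunE => /f0i/si.
  by rewrite copy_of_comp E -copy_of_comp; apply/eqP; congr copy_of; apply/ffunP => x; rewrite !ffunE.
have ex x : exists y, f0 y == f x.
  have: f x \in (copy_of H f0).1 by rewrite -E; apply: imset_f.
  by case/imsetP=> y _ ->; exists y.
pose s := [ffun x => xchoose (ex x)].
have fs x : f0 (s x) = f x by rewrite ffunE (eqP (xchooseP (ex x))).
have si : injective s by move=> x y e; apply: fi; rewrite -!fs e.
exists s; last by apply/ffunP => x; rewrite ffunE fs.
rewrite inE; apply/andP; split; first exact/injectiveP.
have: copy_of H [ffun x => f0 (s x)] = copy_of H f0.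
  by rewrite -E; congr copy_of; apply/ffunP => x; rewrite ffunE fs.
rewrite copy_of_comp copy_of_id [RHS]/copy_of => -[e1 e2].
rewrite [copy_of H s]surjective_pairing; apply/eqP; congr (_, _).
  by apply: (imset_inj f0i); rewrite e1; apply/setP=> z;
    apply/imsetP/imsetP => -[y _ ->]; exists y; rewrite ?inE.
by apply: (imset_inj (imset_inj f0i)); rewrite e2.
Qed.

Lemma card_injhoms : #|injhoms H G| = #|auts| * ncopies H G.
Proof.
rewrite -[LHS]sum1_card.
set A := [set K | subgraph_of G K && isomorphic_to H K].
rewrite (partition_big (copy_of H) (mem A)) => [|f fI]; last first.
  suff: copy_of H f \in A by [].
  by rewrite copies_copy_of; apply/existsP; exists f; rewrite fI eqxx.
rewrite mulnC /ncopies -sum_nat_const; apply: eq_bigr => K KA.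
have: K \in A by [].
rewrite copies_copy_of => /existsP[f0]; rewrite inE => /andP[/andP[/injectiveP f0i f0h] /eqP <-].
rewrite sum1_card -(card_copy_fiber f0i); apply: eq_card => f; rewrite !inE unfold_in /=.
by rewrite !inE -andbA; case: (injectiveb f) => //=; case: eqP => [E|_]; rewrite ?andbF //
  copy_of_subgraph E -copy_of_subgraph f0h.
Qed.

Lemma auts_gt0 : 0 < #|auts|.
Proof.
apply/card_gt0P; exists [ffun x => x]; rewrite inE eqxx andbT.
by apply/injectiveP => x y; rewrite !ffunE.
Qed.

Lemma freeP : reflect (forall f : {ffun S -> T}, injective f -> ~ is_hom H G f) (free H G).
Proof.
rewrite /free.
have -> : (ncopies H G == 0) = (#|injhoms H G| == 0).
  by rewrite card_injhoms muln_eq0 (gtn_eqF (auts_gt0)).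
rewrite cards_eq0; apply: (iffP eqP) => [/setP E f /injectiveP fi fh|E].
  by move: (E f); rewrite !inE fh fi.
by apply/setP=> f; rewrite !inE; apply/andP=> -[/injectiveP fi]; exact: E.
Qed.

End Aut.

Lemma adj_complete k (x y : 'I_k) : adj (complete k) x y = (x != y).
Proof. by rewrite /adj inE cards2; case: (x != y). Qed.

Lemma chi_complete k : chi (complete k) = k.
Proof.
rewrite /chi; case: ex_minnP => m /existsP[c /forallP hc] mmin.
apply/eqP; rewrite eqn_leq mmin /=; last first.
  apply/existsP; exists [ffun x => x]; apply/forallP => x; apply/forallP => y.
  by rewrite !ffunE adj_complete implybb.
suff ci : injective c by have := leq_card c ci; rewrite !card_ord.
move=> x y cxy; apply/eqP; apply/negPn/negP => xy.
by move/forallP: (hc x) => /(_ y); rewrite adj_complete xy cxy eqxx.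
Qed.

Lemma colorable_chi (S : finType) (F : sgraph S) k : colorable F k -> chi F <= k.
Proof. by rewrite /chi; case: ex_minnP => m _; apply. Qed.

Lemma chi_colorable (S : finType) (F : sgraph S) : colorable F (chi F).
Proof. by rewrite /chi; case: ex_minnP. Qed.

(** Composing an embedding of F with the part map would properly colour F with k colours. *)
Lemma kpartite_free (S T : finType) (F : sgraph S) (G : sgraph T) k :
  complete_kpartite k G -> k < chi F -> free F G.
Proof.
move=> [c cG] kF; apply/freeP => f fi /is_homP fh.
move: kF; rewrite ltnNge => /negP; apply; apply: colorable_chi.
apply/existsP; exists [ffun x => c (f x)]; apply/forallP => x; apply/forallP => y.
by apply/implyP => /fh; rewrite cG !ffunE.
Qed.

Local Open Scope ring_scope.

(** * Cliques in F-free graphs *)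

Lemma natr_card (R : pzSemiRingType) (T : finType) (A : {pred T}) :
  #|A|%:R = \sum_x (x \in A)%:R :> R.
Proof. by rewrite -sum1_card natr_sum big_mkcond; apply: eq_bigr => x _; case: (x \in A). Qed.

Section Cliques.
Variables (T : finType) (G : sgraph T).

Definition nbr x := [set y | adj G x y].

Definition cliques r (S : {set T}) :=
  [set p : r.-tuple T | pairwise (adj G) p && all (mem S) p].

Lemma cliques_cons r S x (p : r.-tuple T) :
  (cons_tuple x p \in cliques r.+1 S) = (x \in S) && (p \in cliques r (S :&: nbr x)).
Proof.
rewrite !inE /=.
have -> : all (mem (S :&: nbr x)) p = all (mem S) p && all (adj G x) p.
  by rewrite -all_predI; apply: eq_all => y; rewrite /= !inE.
by do !case: (all _ _); rewrite /= ?andbT ?andbF // andbC.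
Qed.

Lemma sum_cons_tuple r (P : pred (r.+1.-tuple T)) (E : nat) :
  (\sum_(p | P p) E = \sum_x \sum_(p | P (cons_tuple x p)) E)%N.
Proof.
rewrite (reindex (fun q : T * r.-tuple T => cons_tuple q.1 q.2)) /=.
  by rewrite pair_big_dep.
exists (fun p => (thead p, behead_tuple p)) => [[x p] _|p _] /=.
  by congr (_, _); apply: val_inj.
by rewrite [RHS]tuple_eta; apply: val_inj.
Qed.

Lemma card_cliquesS r S :
  #|cliques r.+1 S| = (\sum_(x in S) #|cliques r (S :&: nbr x)|)%N.
Proof.
rewrite -sum1_card [LHS]sum_cons_tuple [RHS]big_mkcond; apply: eq_bigr => x _.
rewrite -[X in if _ then X else _]sum1_card big_mkcond /=.
case xS: (x \in S); last by apply: big1 => p _; rewrite cliques_cons xS.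
by rewrite [RHS]big_mkcond; apply: eq_bigr => p _; rewrite cliques_cons xS.
Qed.

(** Here the cliques are grouped by their tail, whereas [card_cliquesS] groups them by their first
    vertex. *)
Lemma card_cliquesS_nbr r S :
  #|cliques r.+1 S| = (\sum_(p in cliques r S) #|[set x in S | all (adj G x) p]|)%N.
Proof.
rewrite -sum1_card [LHS]sum_cons_tuple.
under eq_bigr => x _ do rewrite big_mkcond /=.
rewrite exchange_big [RHS]big_mkcond; apply: eq_bigr => p _ /=.
have E x : (cons_tuple x p \in cliques r.+1 S) =
    (p \in cliques r S) && (x \in [set x in S | all (adj G x) p]).
  rewrite !inE /=; move: (all _ _) (pairwise _ _) (all (adj G x) p) (x \in S).
  by do 4!case.
under eq_bigr => x _ do rewrite E.
case: (p \in _); last by rewrite big1.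
by rewrite -big_mkcond sum1_card.
Qed.

End Cliques.

Lemma subn_exp_le_ffact n m : ((n - m) ^ m <= n ^_ m)%N.
Proof.
have h i : (i <= m -> (n - m) ^ i <= n ^_ i)%N.
  elim: i => // i IH im; rewrite expnSr ffactnSr leq_mul ?IH ?(ltnW im) //.
  by rewrite leq_sub2l // ltnW.
exact: h.
Qed.

(** * Supersaturation: many cliques force a large complete multipartite subgraph *)

Section Erdos.
Variable R : realType.
Variable V : finType.

(* Double count the pairs of an r-clique p and an injection of V into the common
   neighbourhood of p. *)
Lemma blowup_step r (c : R) : 0 < c -> exists (c' : R) (n0 : nat), 0 < c' /\
  forall (T : finType) (G : sgraph T) (S : {set T}), (n0 <= #|T|)%N ->
    c * #|T|%:R ^+ r.+1 <= #|cliques G r.+1 S|%:R ->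
    exists y : {ffun V -> T}, [/\ injective y, forall v, y v \in S &
      c' * #|T|%:R ^+ r <= #|cliques G r (S :&: \bigcap_v nbr G (y v))|%:R].
Proof.
move=> c0; set t := #|V|.
(* Averaging will give (c/2)(c/4)^t n^r cliques for some injection. The constant is half of that,
   which makes the failure of every injection contradictory. *)
pose c' : R := (c / 4) * (c / 4) ^+ t.
have c'0 : 0 < c' by rewrite /c' mulr_gt0 ?exprn_gt0 ?divr_gt0.
have [n0 hn0] : exists n0 : nat, t%:R / (c / 4) < n0%:R :> R.
  exists (Num.bound (t%:R / (c / 4))); apply: le_lt_trans (archi_boundP _); first by [].
  by rewrite divr_ge0 // divr_ge0 // ltW.
exists c', n0.+1; split=> // T G S n0T clS.
set n : R := #|T|%:R.
have n_gt0 : 0 < n by rewrite ltr0n (leq_trans _ n0T).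
have c2n : 0 <= c / 2 * n by rewrite mulr_ge0 // ?ltW // divr_gt0.
have c4n : 0 <= c / 4 * n by rewrite mulr_ge0 // ?ltW // divr_gt0.
have tn : t%:R <= c / 4 * n.
  rewrite mulrC -ler_pdivrMr ?divr_gt0 //; apply: (le_trans (ltW hn0)).
  by rewrite ler_nat ltnW.
pose D p := [set x in S | all (adj G x) p].
(* The r-cliques with many extensions in S. The others extend to at most (c/2)n^(r+1) cliques
   altogether, so at least (c/2)n^r cliques are in [Q]. *)
pose Q := [set p in cliques G r S | c / 2 * n <= #|D p|%:R].
have Qbig : c / 2 * n ^+ r <= #|Q|%:R.
  have: #|cliques G r.+1 S|%:R <= #|Q|%:R * n + n ^+ r * (c / 2 * n).
    rewrite card_cliquesS_nbr natr_sum.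
    have -> : #|Q|%:R * n + n ^+ r * (c / 2 * n) =
        \sum_(p : r.-tuple T) ((p \in Q)%:R * n + c / 2 * n).
      rewrite big_split /= sumr_const card_tuple -mulr_suml natr_card.
      by rewrite -[c / 2 * n *+ _]mulr_natl natrX.
    rewrite big_mkcond; apply: ler_sum => p _; case: ifP => pS; last first.
      by rewrite addr_ge0 // mulr_ge0 ?ler0n // ltW.
    rewrite inE pS /=; case: (leP (c / 2 * n)) => Dp /=.
      by rewrite mul1r ler_wpDr ?ler_nat ?max_card.
    by rewrite mul0r add0r ltW.
  move=> /(le_trans clS); rewrite exprSr => h.
  rewrite -(ler_pM2r n_gt0); lra.
pose Z (y : {ffun V -> T}) := [set p in Q | [forall v, y v \in D p]].
pose I := [set y : {ffun V -> T} | injectiveb y].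
have sumZ : c / 2 * n ^+ r * (c / 4 * n) ^+ t <= (\sum_(y in I) #|Z y|)%:R.
  (* For a fixed clique p, the injections of V into its set of extensions number [#|D p| ^_ t]. *)
  have -> : (\sum_(y in I) #|Z y| = \sum_(p in Q) #|D p| ^_ t)%N.
    under eq_bigr do rewrite -sum1_card.
    rewrite (exchange_big_dep [in Q]) /= => [|y p _]; last by rewrite inE => /andP[].
    apply: eq_bigr => p pQ; rewrite -card_inj_ffuns_on -sum1_card; apply: eq_bigl => y.
    rewrite [y \in I]inE [p \in Z y]inE pQ [RHS]inE /=.
    by rewrite andbC; congr (_ && _); apply/forallP/ffun_onP.
  rewrite natr_sum; apply: le_trans (_ : \sum_(p in Q) (c / 4 * n) ^+ t <= _).
    by rewrite sumr_const -[leRHS]mulr_natl ler_wpM2r // exprn_ge0.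
  apply: ler_sum => p; rewrite inE => /andP[_ pD].
  apply: le_trans (_ : ((#|D p| - t) ^ t)%:R <= _); last by rewrite ler_nat subn_exp_le_ffact.
  have tD : (t <= #|D p|)%N by rewrite -(ler_nat R); lra.
  rewrite natrX natrB // lerXn2r ?nnegrE; lra.
have [y yI Zy] : exists2 y, y \in I & c' * n ^+ r <= #|Z y|%:R.
  apply/exists_inP; apply: contraT => /exists_inPn nZ.
  have: (\sum_(y in I) #|Z y|)%:R <= c' * n ^+ r * n ^+ t.
    rewrite natr_sum; apply: le_trans (_ : \sum_(y in I) c' * n ^+ r <= _).
      by apply: ler_sum => y /nZ; rewrite -ltNge => /ltW.
    rewrite sumr_const -[leLHS]mulr_natr ler_wpM2l //.
      by rewrite mulr_ge0 ?exprn_ge0 // ltW.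
    by rewrite /n -natrX ler_nat -card_ffun max_card.
  move=> /(le_trans sumZ); rewrite exprMn => h.
  suff: 2 * (c' * n ^+ r * n ^+ t) <= c' * n ^+ r * n ^+ t.
    have : 0 < c' * n ^+ r * n ^+ t by rewrite mulr_gt0 ?exprn_gt0 // mulr_gt0 ?exprn_gt0.
    by set z := _ * _ * _ => z0 zz; exfalso; lra.
  by apply: le_trans h; rewrite /c' le_eqVlt; apply/orP; left; apply/eqP; field.
have Z0 : (0 < #|Z y|)%N.
  by rewrite -(ltr0n R); apply: lt_le_trans Zy; rewrite mulr_gt0 ?exprn_gt0.
exists y; split.
- by move: yI; rewrite inE => /injectiveP.
- move=> v; case/card_gt0P: Z0 => p; rewrite inE => /andP[_ /forallP/(_ v)].
  by rewrite inE => /andP[].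
apply: (le_trans Zy); rewrite ler_nat; apply/subset_leq_card/subsetP => p.
rewrite !inE => /andP[/andP[/andP[-> pS] _] /forallP yp] /=.
apply/allP=> x xp; have /= := allP pS x xp; rewrite /= inE => -> /=; apply/bigcapP => v _.
by move: (yp v); rewrite !inE => /andP[_ /allP/(_ x xp)]; rewrite adjC.
Qed.

(** Iterating [blowup_step]: each new class is found with many smaller cliques left in its common
    neighbourhood, and all later classes are taken inside that neighbourhood. *)
Lemma blowup r (c : R) : 0 < c -> exists n0 : nat,
  forall (T : finType) (G : sgraph T) (S : {set T}), (n0 <= #|T|)%N ->
    c * #|T|%:R ^+ r <= #|cliques G r S|%:R ->
    exists Y : nat -> {ffun V -> T},
      [/\ forall i, (i < r)%N -> injective (Y i),
          forall i v, (i < r)%N -> Y i v \in S &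
          forall i j v w, (i < r)%N -> (j < r)%N -> i != j -> adj G (Y i v) (Y j w)].
Proof.
elim: r c => [|r IH] c c0.
  (* No class is required when r = 0, but defining [Y] still takes a vertex. *)
  exists 1%N => T G S /card_gt0P[x _] _.
  by exists (fun=> [ffun=> x]).
have [c' [n0 [c'0 step]]] := blowup_step r c0.
have [n1 IH'] := IH c' c'0.
exists (maxn n0 n1) => T G S; rewrite geq_max => /andP[n0T n1T] clS.
have [y [yi yS cly]] := step T G S n0T clS.
have [Y [Yi YS YY]] := IH' T G _ n1T cly.
have yY v i w : (i < r)%N -> adj G (y v) (Y i w).
  by move=> ir; have := YS i w ir; rewrite inE => /andP[_ /bigcapP/(_ v isT)]; rewrite inE.
exists (fun i => if i is i'.+1 then Y i' else y); split.
- by case=> // i; exact: Yi.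
- by case=> [|i] v //= ir; have := YS i v ir; rewrite inE => /andP[].
- case=> [|i] [|j] v w //= ir jr.
  + by move=> _; exact: yY.
  + by move=> _; rewrite adjC; exact: yY.
  + by rewrite eqSS; exact: YY.
Qed.

(** Otherwise [blowup] gives [chi F] classes, completely joined to each other, each with one vertex
    per vertex of F. Sending v to its own vertex in the class of its colour embeds F. *)
Lemma free_few_cliques (F : sgraph V) (c : R) : 0 < c -> exists n0 : nat,
  forall (T : finType) (G : sgraph T), (n0 <= #|T|)%N -> free F G ->
    #|cliques G (chi F) setT|%:R < c * #|T|%:R ^+ chi F.
Proof.
move=> c0; have [n0 blow] := blowup (chi F) c0; exists n0 => T G n0T /freeP Ffree.
rewrite ltNge; apply/negP => /(blow T G _ n0T)[Y [Yi _ YY]].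
have /existsP[col /forallP hcol] := chi_colorable F.
have colP x y : adj F x y -> col x != col y.
  by move=> xy; move/forallP: (hcol x) => /(_ y); rewrite xy.
apply: (Ffree [ffun v => Y (col v) v]).
  move=> v w; rewrite !ffunE; have [cvw|cvw] := eqVneq (col v) (col w).
    by rewrite cvw; apply: Yi; apply: ltn_ord.
  move=> E; have := YY _ _ v w (ltn_ord (col v)) (ltn_ord (col w)) cvw.
  by rewrite E adj_irr.
apply/is_homP => v w /colP cvw; rewrite !ffunE.
exact: YY.
Qed.
End Erdos.

(** * Graphs with few twin defects *)

Section Structure.
Variable R : realType.

Section Greedy.
Variables (T : finType) (G : sgraph T).

(** In a complete multipartite graph non-adjacent vertices have the same neighbours, so no such
    triple exists. Being a condition on three vertices, it can be estimated from samples. *)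
Definition twin_defect (v x y : T) : bool := ~~ adj G v x && (adj G v y != adj G x y).

Definition defects v := [set p : T * T | twin_defect v p.1 p.2].

(** Colour j is reserved for leftover vertices; only pairs coloured below j are tested. *)
Definition errs (S : {set T}) (c : T -> nat) j :=
  [set p : T * T | [&& p.1 \in S, p.2 \in S, c p.1 < j, c p.2 < j
     & adj G p.1 p.2 != (c p.1 != c p.2)]%N].

(** Induction on j. Choose v in S outside B whose neighbourhood contains few (j+1)-cliques, make its
    non-neighbours in S one class, and recurse inside the neighbourhood. Every wrong pair meeting
    the new class is a twin defect of v in one of the two orders, hence the cost 2b per class. If no
    such v exists, multiplying by [#|S :\: B|] gives many (j+2)-cliques. *)
Lemma greedy_coloring (e b : R) (B : {set T}) :
  0 <= e -> 0 <= b -> #|B|%:R <= e ->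
  (forall v, v \notin B -> #|defects v|%:R <= b) ->
  forall j (S : {set T}),
  e ^+ j.+1 <= #|cliques G j.+1 S|%:R \/
  exists c : T -> nat, [/\ forall x, (c x <= j)%N,
    #|[set x in S | c x == j]|%:R <= 2 * e &
    #|errs S c j|%:R <= 2 * b *+ j].
Proof.
move=> e0 b0 Be Bb; elim=> [|j IH] S.
  have [eS|Se] := lerP e #|S|%:R; [left|right].
    rewrite expr1 card_cliquesS; apply: le_trans eS _; rewrite ler_nat -sum1_card.
    apply: leq_sum => x _; apply/card_gt0P; exists [tuple]; by rewrite inE.
  exists (fun=> 0%N); split=> //.
    apply: le_trans (_ : #|S|%:R <= _); last by apply: (le_trans (ltW Se)); rewrite ler_peMl ?ler1n.
    by rewrite ler_nat subset_leq_card //; apply/subsetP=> x; rewrite inE => /andP[].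
  by rewrite mulr0n /errs (_ : [set _ | _] = set0) ?cards0 //; apply/setP=> p; rewrite !inE !ltn0 !andbF.
(* When few vertices of S lie outside B, all of S is left over; it has at most e + e vertices. *)
have [SB|SB] := ltrP #|S :\: B|%:R e.
  right; exists (fun=> j.+1); split=> //.
    apply: le_trans (_ : (#|S :\: B| + #|B|)%:R <= _); last by rewrite natrD; lra.
    rewrite ler_nat; apply: leq_trans (leq_card_setU _ _).
    by apply/subset_leq_card/subsetP=> x; rewrite !inE => /andP[-> _]; rewrite andbT orNb.
  rewrite /errs (_ : [set _ | _] = set0) ?cards0 ?mulrn_wge0 ?mulr_ge0 //.
  by apply/setP=> p; rewrite !inE !ltnn !andbF.
have [/exists_inP[v vSB vlt]|/exists_inPn allv] :=
    boolP [exists v in S :\: B, #|cliques G j.+1 (S :&: nbr G v)|%:R < e ^+ j.+1]; last first.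
  left; rewrite exprS; apply: le_trans (_ : #|S :\: B|%:R * e ^+ j.+1 <= _).
    by rewrite ler_wpM2r ?exprn_ge0.
  rewrite card_cliquesS natr_sum; apply: le_trans (_ : \sum_(x in S :\: B) e ^+ j.+1 <= _).
    by rewrite sumr_const mulr_natl.
  rewrite big_mkcond [leRHS]big_mkcond; apply: ler_sum => x _.
  case: ifP => [xSB|_]; last by case: ifP.
  have /andP[_ ->] : (x \notin B) && (x \in S) by rewrite -in_setD.
  by have := allv x xSB; rewrite -leNgt.
right; have [|[c [cj cS cerr]]] := IH (S :&: nbr G v); first by rewrite leNgt vlt.
have vB : v \notin B by move: vSB; rewrite inE => /andP[].
(* Colour 0 is the new class and the recursive colours are shifted by one, so the leftover colour j
   becomes j+1. *)
exists (fun x => if adj G v x then (c x).+1 else 0%N); split.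
- by move=> x; case: ifP => // _; rewrite ltnS.
- apply: le_trans cS; rewrite ler_nat; apply/subset_leq_card/subsetP=> x.
  by rewrite !inE; case: (adj G v x); rewrite ?eqSS ?andbT ?andbF.
have := Bb v vB; set D := defects v => Db.
pose D' := [set (p.2, p.1) | p in D].
have D'D : (#|D'| <= #|D|)%N by exact: leq_imset_card.
apply: le_trans (_ : (#|errs (S :&: nbr G v) c j| + (#|D| + #|D'|))%:R <= _); last first.
  by rewrite mulrS !natrD; move: D'D; rewrite -(ler_nat R); lra.
rewrite ler_nat.
apply: leq_trans (leq_add (leqnn _) (leq_card_setU _ _)).
apply: leq_trans (leq_card_setU _ _).
apply/subset_leq_card/subsetP => -[x y]; rewrite !inE /=.
have -> : ((x, y) \in D') = twin_defect v y x.
  apply/imsetP/idP => [[[z t]]|d]; first by rewrite inE /= => d [-> ->].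
  by exists (y, x); rewrite ?inE.
rewrite /twin_defect (adjC G y x).
case: (adj G v x); case: (adj G v y); rewrite /= ?eqSS ?ltnS;
  by case: (adj G x y); case: (x \in S); case: (y \in S) => //=; rewrite ?orbF ?orbT ?andbF.
Qed.

End Greedy.

Definition twin_defects (T : finType) (G : sgraph T) :=
  [set t : T * T * T | twin_defect G t.1.1 t.1.2 t.2].

Lemma sum_defects (T : finType) (G : sgraph T) :
  (\sum_v #|defects G v| = #|twin_defects G|)%N.
Proof.
rewrite -[RHS]sum1_card.
under eq_bigr => v _ do rewrite -sum1_card.
rewrite pair_big_dep /= (reindex (fun t : T * T * T => (t.1.1, (t.1.2, t.2)))) /=.
  by apply: eq_bigl => t; rewrite !inE.
by exists (fun t => (t.1, t.2.1, t.2.2)) => [[[? ?] ?]|[? [? ?]]].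
Qed.

(** Markov's inequality bounds the set of vertices with many defects. The greedy colouring then
    applies to the whole vertex set, its clique alternative being excluded by the bound on
    (k+1)-cliques. *)
Lemma near_kpartite k (eps : R) : 0 < eps -> exists2 d : R, 0 < d &
  forall (T : finType) (G : sgraph T), (0 < #|T|)%N ->
    #|twin_defects G|%:R <= d * #|T|%:R ^+ 3 ->
    #|cliques G k.+1 setT|%:R <= d * #|T|%:R ^+ k.+1 ->
    exists c : T -> 'I_k, #|diff_pairs G (partite c)|%:R <= eps * #|T|%:R ^+ 2.
Proof.
move=> eps0.
(* With [eta], the pairs meeting the leftover class cost at most eps/2; with [beta], the k rounds of
   errors cost at most eps/2. The two bounds in [d] serve Markov's inequality and the contradiction
   with many cliques. *)
pose eta := Num.min (eps / 8) (1 / 4).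
pose beta := eps / (4 * k.+1%:R).
pose d := Num.min (eta * beta) (eta ^+ k.+1 / 2).
have eta0 : 0 < eta by rewrite lt_min !divr_gt0.
have beta0 : 0 < beta by rewrite divr_gt0 ?mulr_gt0.
have d0 : 0 < d by rewrite lt_min mulr_gt0 //= divr_gt0 // exprn_gt0.
exists d => // T G T0 hD hC.
set n : R := #|T|%:R in hD hC *.
have n0 : 0 < n by rewrite ltr0n.
pose B := [set v | beta * n ^+ 2 < #|defects G v|%:R].
have Bn : #|B|%:R <= eta * n.
  have : #|B|%:R * (beta * n ^+ 2) <= d * n ^+ 3.
    apply: le_trans hD; rewrite -sum_defects natr_sum mulr_natl -sumr_const.
    rewrite big_mkcond; apply: ler_sum => v _; case: ifP => //.
    by rewrite inE => /ltW.
  move=> /le_trans/(_ (_ : _ <= eta * beta * n ^+ 3)) h.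
  have {}h : #|B|%:R * (beta * n ^+ 2) <= eta * n * (beta * n ^+ 2).
    apply: le_trans (h _) _; last by rewrite le_eqVlt; apply/orP; left; apply/eqP; ring.
    by rewrite ler_wpM2r ?exprn_ge0 ?(ltW n0) // ge_min lexx.
  by move: h; rewrite ler_pM2r // mulr_gt0 ?exprn_gt0.
have e0 : 0 <= eta * n by rewrite mulr_ge0 // ltW.
have b0 : 0 <= beta * n ^+ 2 by rewrite mulr_ge0 ?exprn_ge0 // ltW.
have Bb v : v \notin B -> #|defects G v|%:R <= beta * n ^+ 2 by rewrite inE -leNgt.
have [h|[c [cj cS cerr]]] := greedy_coloring e0 b0 Bn Bb k setT.
- have : (eta * n) ^+ k.+1 <= eta ^+ k.+1 / 2 * n ^+ k.+1.
    apply: le_trans h _; apply: le_trans hC _.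
    by rewrite ler_wpM2r ?exprn_ge0 ?(ltW n0) // ge_min lexx orbT.
  rewrite exprMn ler_pM2r ?exprn_gt0 //.
  have : 0 < eta ^+ k.+1 by rewrite exprn_gt0.
  by move: (eta ^+ k.+1) => z; lra.
have eta8 : eta <= eps / 8 by rewrite ge_min lexx.
have eta4 : eta <= 1 / 4 by rewrite ge_min lexx orbT.
(* For k = 0 every vertex would be left over, whereas at most half of them are. *)
have k0 : (0 < k)%N.
  rewrite lt0n; apply/eqP => k0.
  have : n <= 2 * (eta * n).
    apply: le_trans cS; rewrite ler_nat -cardsT subset_leq_card //.
    by apply/subsetP=> x _; have := cj x; rewrite !inE k0 leqn0.
  rewrite mulrA -{1}[n]mul1r ler_pM2r //; lra.
pose L := [set x | c x == k].
have Ln : #|L|%:R <= 2 * (eta * n).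
  apply: le_trans cS; rewrite ler_nat subset_leq_card //.
  by apply/subsetP=> x; rewrite !inE.
(* The leftover colour k is out of range, so [insubd] merges it into colour 0. *)
exists (fun x => insubd (Ordinal k0) (c x)).
apply: le_trans (_ : (#|errs G setT c k| + (#|setX L [set: T]| + #|setX [set: T] L|))%:R <= _).
  rewrite ler_nat.
  apply: leq_trans (leq_add (leqnn _) (leq_card_setU _ _)).
  apply: leq_trans (leq_card_setU _ _).
  apply/subset_leq_card/subsetP => -[x y]; rewrite !inE /= adj_partite.
  have := cj y; rewrite leq_eqVlt; case: (c y == k) => /= [_|cy]; first by rewrite !orbT.
  have := cj x; rewrite leq_eqVlt; case: (c x == k) => /= [_|cx]; first by rewrite !orbT.
  rewrite cx cy /= !orbF.
  by rewrite -(inj_eq val_inj) /= !val_insubd cx cy.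
rewrite !cardsX cardsT !natrD !natrM -/n.
have : #|errs G setT c k|%:R <= eps / 2 * n ^+ 2.
  apply: le_trans cerr _; rewrite -mulr_natr /beta.
  have -> : 2 * (eps / (4 * k.+1%:R) * n ^+ 2) * k%:R
     = eps / 2 * n ^+ 2 * (k%:R / k.+1%:R) by field; rewrite ?natr1 ?nat1r pnatr_eq0.
  rewrite ger_pMr; last by rewrite mulr_gt0 ?exprn_gt0 // divr_gt0.
  by rewrite ler_pdivrMr ?ltr0n // mul1r ler_nat.
have : #|L|%:R * n <= eps / 4 * n ^+ 2.
  rewrite expr2 mulrA ler_pM2r //; apply: le_trans Ln _.
  by rewrite mulrA ler_pM2r //; lra.
rewrite [n * _]mulrC; lra.
Qed.

End Structure.

Local Close Scope ring_scope.

(** * Counting through pullbacks *)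

(** A map prescribed on the image of [psi] extends freely to the other [#|M| - #|S|] points. *)
Lemma card_ffun_comp (S M T : finType) (psi : S -> M) (P : pred {ffun S -> T}) :
  injective psi ->
  #|[set s : {ffun M -> T} | P [ffun x => s (psi x)]]| = #|[set f | P f]| * #|T| ^ (#|M| - #|S|).
Proof.
move=> psi_inj.
rewrite -sum1_card (partition_big (fun s : {ffun M -> T} => [ffun x => s (psi x)] : {ffun S -> T})
  (mem [set f | P f])) => [|s]; last by rewrite !inE.
rewrite -sum_nat_const; apply: eq_bigr => f; rewrite /= inE => Pf.
pose F x : pred T := [pred t | [forall y, (psi y == x) ==> (t == f y)]].
rewrite sum1_card; transitivity #|(family F : simpl_pred {ffun M -> T})|.
  apply: eq_card => s; rewrite unfold_in /= inE; apply/andP/familyP => [[_ /eqP E] x|sF].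
    by rewrite inE; apply/forallP=> y; apply/implyP=> /eqP <-; rewrite -E ffunE.
  have E : [ffun x => s (psi x)] = f.
    apply/ffunP=> y; rewrite ffunE; apply/eqP.
    by have := sF (psi y); rewrite inE => /forallP/(_ y); rewrite eqxx.
  by rewrite E eqxx.
rewrite card_family foldrE big_map big_enum /=.
rewrite (bigID [in codom psi]) /= big1 ?mul1n => [|x /codomP[y ->]].
  rewrite (eq_bigr (fun=> #|T|)) => [|x xpsi].
    rewrite prod_nat_const; congr (_ ^ _).
    by rewrite -(card_codom psi_inj) -(cardC [in codom psi]) addKn.
  apply: eq_card => t; rewrite !inE; apply/forallP => y; apply/implyP => /eqP E.
  by rewrite -E codom_f in xpsi.
rewrite -(card1 (f y)); apply: eq_card => t; rewrite !inE; apply/forallP/eqP => [/(_ y)|-> z].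
  by rewrite eqxx => /eqP.
by apply/implyP => /eqP/psi_inj ->.
Qed.

(** Double counting of pairs (s, f): for each injective f, the composite of s and f runs uniformly
    over all maps from S to T. Injective occurrences in samples thus measure arbitrary occurrences
    in G. The property Q is given for all vertex types because it is read both in the sample and in
    G. *)
Lemma sum_pull (S M T : finType) (G : sgraph T)
    (Q : forall U : finType, sgraph U -> {ffun S -> U} -> bool) :
  (forall (s : {ffun M -> T}) (f : {ffun S -> M}),
    Q M (pull s G) f = Q T G [ffun x => s (f x)]) ->
  \sum_(s : {ffun M -> T}) #|[set f : {ffun S -> M} | injectiveb f && Q M (pull s G) f]| =
  #|M| ^_ #|S| * (#|[set f | Q T G f]| * #|T| ^ (#|M| - #|S|)).
Proof.
move=> QE; under eq_bigr do rewrite -sum1_card.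
rewrite (exchange_big_dep [in [set f : {ffun S -> M} | injectiveb f]]) /= => [|s f _]; last first.
  by rewrite !inE => /andP[].
rewrite -card_inj_ffuns -sum_nat_const; apply: eq_bigr => f; rewrite inE => f_inj.
have /injectiveP/card_ffun_comp <- := f_inj.
rewrite -sum1_card; apply: eq_bigl => s.
by rewrite !inE f_inj QE.
Qed.

(** Ordered pairs are maps from [bool], and below triples are maps from [option bool], so that
    [sum_pull] covers both. *)
Lemma card_ffun_bool (T : finType) (D : rel T) :
  #|[set f : {ffun bool -> T} | D (f true) (f false)]| = #|[set p : T * T | D p.1 p.2]|.
Proof.
pose g (p : T * T) := [ffun b : bool => if b then p.1 else p.2].
have gi : injective g.
  move=> [x y] [z t] /ffunP E; have := E true; have := E false.
  by rewrite !ffunE /= => -> ->.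
rewrite -[RHS](card_imset _ gi); apply: eq_card => f; rewrite inE.
apply/idP/imsetP => [d|[p]]; last by rewrite inE => d ->; rewrite !ffunE.
exists (f true, f false); rewrite ?inE //.
by apply/ffunP => -[]; rewrite !ffunE.
Qed.

Lemma card_ffun_triple (T : finType) (D : T -> T -> T -> bool) :
  #|[set f : {ffun option bool -> T} | D (f None) (f (Some true)) (f (Some false))]| =
  #|[set t : T * T * T | D t.1.1 t.1.2 t.2]|.
Proof.
pose g (p : T * T * T) :=
  [ffun b : option bool => if b is Some c then if c then p.1.2 else p.2 else p.1.1] : {ffun option bool -> T}.
have gi : injective g.
  move=> [[x y] u] [[z t] v] /ffunP E.
  have := E (Some true); have := E (Some false); have := E None.
  by rewrite !ffunE /= => -> -> ->.
rewrite -[RHS](card_imset _ gi); apply: eq_card => f; rewrite inE.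
apply/idP/imsetP => [d|[p]]; last by rewrite inE => d ->; rewrite !ffunE.
exists (f None, f (Some true), f (Some false)); rewrite ?inE //.
by apply/ffunP => -[[]|]; rewrite !ffunE.
Qed.

(** Both sides carry a power of [#|T|] in order to avoid a subtraction in the exponent. *)
Lemma card_ffun_pair (S T : finType) (D : rel T) (u v : S) : u != v ->
  #|[set f : {ffun S -> T} | D (f u) (f v)]| * #|T| ^ 2 =
  #|[set p : T * T | D p.1 p.2]| * #|T| ^ #|S|.
Proof.
move=> uv; pose psi (b : bool) := if b then u else v.
have psi_inj : injective psi by case=> [] [] //= E; move: uv; rewrite E eqxx.
have S2 : 2 <= #|S| by rewrite -card_bool; exact: leq_card psi_inj.
have := card_ffun_comp (fun f : {ffun bool -> T} => D (f true) (f false)) psi_inj.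
rewrite card_ffun_bool card_bool.
rewrite (_ : [set s : {ffun S -> T} | _] = [set f : {ffun S -> T} | D (f u) (f v)]); last first.
  by apply/setP=> f; rewrite !inE !ffunE.
by move=> ->; rewrite -mulnA -expnD subnK.
Qed.

Section Counting.
Variables S T : finType.
Implicit Types (H : sgraph S) (G : sgraph T).

(** A map that is a homomorphism into G but not into G' sends some edge of H to a differing pair.
    The bound is a union over the ordered pairs of vertices of H. *)
Lemma card_injhoms_diff H G G' :
  #|injhoms H G| * #|T| ^ 2 <=
  #|injhoms H G'| * #|T| ^ 2 + #|S| ^ 2 * (#|diff_pairs G G'| * #|T| ^ #|S|).
Proof.
pose D := fun x y => adj G x y != adj G' x y.
pose I := [set p : S * S | p.1 != p.2].
have sub : injhoms H G \subset
    injhoms H G' :|: \bigcup_(p in I) [set f : {ffun S -> T} | D (f p.1) (f p.2)].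
  apply/subsetP => f; rewrite !inE => /andP[fi /is_homP fh]; rewrite fi /=.
  have [//|/forallPn[x /forallPn[y]]] := boolP (is_hom H G' f).
  rewrite negb_imply => /andP[xy nxy]; apply/bigcupP; exists (x, y).
    by rewrite inE /= (adj_neq xy).
  by rewrite inE /D fh //= (negbTE nxy).
apply: leq_trans (leq_mul (subset_leq_card sub) (leqnn _)) _.
apply: leq_trans (leq_mul (leq_card_setU _ _) (leqnn _)) _.
rewrite mulnDl leq_add2l.
apply: leq_trans (_ : \sum_(p in I) #|[set f : {ffun S -> T} | D (f p.1) (f p.2)]| * #|T| ^ 2 <= _).
  rewrite -big_distrl leq_mul2r; apply/orP; right.
  elim/big_rec2: _ => [|p x A _ IH]; first by rewrite cards0.
  by apply: leq_trans (leq_card_setU _ _) _; rewrite leq_add2l.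
rewrite (eq_bigr (fun=> #|diff_pairs G G'| * #|T| ^ #|S|)) => [|p]; last first.
  by rewrite inE => /card_ffun_pair ->.
by rewrite sum_nat_const leq_mul // -mulnn -card_prod max_card.
Qed.

Lemma leq_card_homs H G : #|injhoms H G| <= #|homs H G|.
Proof. by apply/subset_leq_card/subsetP => f; rewrite !inE => /andP[]. Qed.

Lemma leq_card_injhoms H G : #|injhoms H G| <= #|T| ^ #|S|.
Proof. by rewrite -card_ffun max_card. Qed.

End Counting.

Lemma sum_injhoms_pull (S M T : finType) (H : sgraph S) (G : sgraph T) :
  \sum_(s : {ffun M -> T}) #|injhoms H (pull s G)| =
  #|M| ^_ #|S| * (#|homs H G| * #|T| ^ (#|M| - #|S|)).
Proof.
rewrite -(@sum_pull S M T G (fun U => is_hom H)) => [|s f]; first by apply: eq_bigr.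
apply/is_homP/is_homP => h x y /h; first by rewrite !ffunE adj_pull.
by rewrite adj_pull !ffunE.
Qed.

Lemma sum_adj_pull (M T : finType) (G : sgraph T) :
  \sum_(s : {ffun M -> T}) #|[set p : M * M | adj (pull s G) p.1 p.2]| =
  #|M| ^_ 2 * (#|[set p : T * T | adj G p.1 p.2]| * #|T| ^ (#|M| - 2)).
Proof.
rewrite -(@card_ffun_bool T) -card_bool.
rewrite -(@sum_pull bool M T G (fun U (G : sgraph U) f => adj G (f true) (f false))).
  apply: eq_bigr => s _; rewrite -card_ffun_bool; apply: eq_card => f; rewrite !inE.
  case a: adj; rewrite ?andbF // andbT; apply/esym/injectiveP.
  by case=> [] [] // E; move: a; rewrite E adj_irr.
by move=> s f; rewrite adj_pull !ffunE.
Qed.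

Lemma sum_twin_defects_pull (M T : finType) (G : sgraph T) :
  \sum_(s : {ffun M -> T}) #|twin_defects (pull s G)| =
  #|M| ^_ 3 * (#|twin_defects G| * #|T| ^ (#|M| - 3)).
Proof.
have c3 : #|{: option bool}| = 3 by rewrite card_option card_bool.
rewrite -(@card_ffun_triple T (twin_defect G)) -c3.
rewrite -(@sum_pull (option bool) M T G
  (fun U (G : sgraph U) f => twin_defect G (f None) (f (Some true)) (f (Some false)))).
  apply: eq_bigr => s _; rewrite -(card_ffun_triple (twin_defect _)); apply: eq_card => f; rewrite !inE.
  (* The entries of a twin defect are distinct, so injectivity holds automatically. *)
  case a: twin_defect; rewrite ?andbF // andbT; apply/esym/injectiveP.
  case=> [[]|] [[]|] // E; move: a; rewrite /twin_defect E ?adj_irr ?eqxx ?andbF //;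
    first [by case: (adj _ _ _) | by rewrite adjC; case: (adj _ _ _)].
by move=> s f; rewrite /twin_defect !adj_pull !ffunE.
Qed.

(** As G' has no twin defect, G and G' differ on one of the three pairs in each twin defect of G. *)
Lemma twin_defects_kpartite (T : finType) (G G' : sgraph T) k :
  complete_kpartite k G' -> #|twin_defects G| <= 3 * (#|diff_pairs G G'| * #|T|).
Proof.
move=> [c cG'].
have [T0|T0] := posnP #|T|.
  rewrite (_ : twin_defects G = set0) ?cards0 //.
  by apply/setP => -[[x]]; have := card0_eq T0 x; rewrite inE.
pose D := fun x y => adj G x y != adj G' x y.
pose A (u v : option bool) := [set f : {ffun option bool -> T} | D (f u) (f v)].
have cA u v : u != v -> #|A u v| = #|diff_pairs G G'| * #|T|.
  move=> /(@card_ffun_pair _ T D); rewrite card_option card_bool (expnS _ 2) mulnA.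
  by move/eqP; rewrite eqn_pmul2r ?expn_gt0 ?T0 // => /eqP.
rewrite /twin_defects -(card_ffun_triple (twin_defect _)).
pose a := A None (Some true); pose b := A None (Some false); pose d := A (Some true) (Some false).
apply: leq_trans (_ : #|a :|: b :|: d| <= _).
  apply/subset_leq_card/subsetP => f; rewrite !inE /D /twin_defect !cG'.
  case: (adj G (f None) (f (Some true))) => //=; case: (c (f None) =P c (f (Some true))) => //= ->.
  by case: (c _ == c _); case: (adj G _ _); case: (adj G _ _).
apply: leq_trans (leq_card_setU _ _) _.
apply: leq_trans (leq_add (leq_card_setU _ _) (leqnn _)) _.
have -> : #|a| = #|diff_pairs G G'| * #|T| by apply: cA.
have -> : #|b| = #|diff_pairs G G'| * #|T| by apply: cA.
have -> : #|d| = #|diff_pairs G G'| * #|T| by apply: cA.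
by move: (_ * _) => z; rewrite !mulSn mul0n addn0 addnA.
Qed.

Lemma homs_complete (T : finType) (G : sgraph T) r :
  #|homs (complete r) G| = #|cliques G r setT|.
Proof.
pose g (p : r.-tuple T) := [ffun i => tnth p i].
have gi : injective g.
  by move=> p q /ffunP E; apply: eq_from_tnth => i; move: (E i); rewrite !ffunE.
rewrite -[RHS](card_imset _ gi); apply: eq_card => f; rewrite inE.
have key (p : r.-tuple T) : is_hom (complete r) G (g p) = (p \in cliques G r setT).
  rewrite inE (_ : all _ p) ?andbT; last by apply/allP => x _; rewrite /= inE.
  apply/is_homP/idP => [h|].
    case E: (val p) => [//|x0 q]; rewrite -{q}E.
    apply/(pairwiseP x0) => i j; rewrite !inE size_tuple => ir jr ij.
    have := h (Ordinal ir) (Ordinal jr); rewrite adj_complete -(inj_eq val_inj) /= neq_ltn ij.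
    by rewrite !ffunE !(tnth_nth x0); apply.
  move=> h i j; have x0 := tnth p i; move/(pairwiseP x0) in h.
  rewrite adj_complete -(inj_eq val_inj) neq_ltn !ffunE !(tnth_nth x0).
  by case/orP => ij; [|rewrite adjC]; apply: h; rewrite ?inE ?size_tuple.
apply/idP/imsetP => [fh|[p pC ->]]; last by rewrite key.
exists [tuple f i | i < r]; last by apply/ffunP => i; rewrite ffunE tnth_mktuple.
rewrite -key; congr (is_true (is_hom _ _ _)): fh.
by apply/ffunP => i; rewrite ffunE tnth_mktuple.
Qed.

Local Open Scope ring_scope.

(** * Random samples *)

Lemma archi_nat (R : realType) (x : R) : exists n : nat, x < n%:R.
Proof.
exists (Num.bound `|x|); apply: le_lt_trans (archi_boundP (normr_ge0 x)).
exact: ler_norm.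
Qed.

(** Induction with e/2 in place of e, since (1 - e/2)^2 is at least 1 - e. *)
Lemma ffact_asymp (R : realType) h (e : R) : 0 < e -> exists n0 : nat,
  forall n, (n0 <= n)%N -> (1 - e) * n%:R ^+ h <= (n ^_ h)%:R.
Proof.
elim: h e => [|h IH] e e0.
  by exists 0%N => n _; rewrite expr0 ffactn0; lra.
have [n0 hn0] := IH (e / 2) (divr_gt0 e0 (ltr0n _ 2)).
have [n1 hn1] := archi_nat (h%:R / (e / 2)).
exists (maxn h (maxn n0 n1)) => n; rewrite !geq_max => /and3P[hn n0n n1n].
rewrite ffactnSr natrM exprSr natrB //.
have [e1|e1] := lerP 1 e.
  apply: le_trans (_ : 0 <= _).
    by rewrite mulr_le0_ge0 ?mulr_ge0 ?exprn_ge0 // subr_le0.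
  by rewrite mulr_ge0 ?ler0n // subr_ge0 ler_nat.
have hn' : h%:R <= e / 2 * n%:R.
  rewrite mulrC -ler_pdivrMr ?divr_gt0 //; apply: (le_trans (ltW hn1)).
  by rewrite ler_nat.
apply: le_trans (_ : (1 - e / 2) * n%:R ^+ h * ((1 - e / 2) * n%:R) <= _).
  rewrite -subr_ge0.
  have -> : (1 - e / 2) * n%:R ^+ h * ((1 - e / 2) * n%:R) - (1 - e) * (n%:R ^+ h * n%:R) =
    (e / 2) ^+ 2 * (n%:R ^+ h * n%:R) by field.
  by rewrite mulr_ge0 ?mulr_ge0 ?exprn_ge0 //; lra.
apply: ler_pM; [| |exact: hn0|lra].
  by rewrite mulr_ge0 ?exprn_ge0 // subr_ge0; lra.
by rewrite mulr_ge0 // subr_ge0; lra.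
Qed.

Section Sampling.
Variable R : realType.
Variables VF VH : finType.

(** Counts on m vertices are carried up to n vertices through blow-ups of T, and back to m through
    samples of G. One [kap] is lost for each of: replacing the extremal graph by T, the falling
    factorial of n, the near-extremality of G, and the falling factorial of m. *)
Lemma sample_lower (k m n : nat) (kap : R) (F : sgraph VF) (H : sgraph VH)
    (T : sgraph 'I_m) (G : sgraph 'I_n) (ex_m : nat) :
  let h := #|VH| in let a := #|auts H|%:R : R in
  0 < kap -> (h <= m)%N -> (h <= n)%N -> (0 < m)%N -> (0 < n)%N ->
  (1 - kap) * m%:R ^+ h <= (m ^_ h)%:R ->
  (1 - kap) * n%:R ^+ h <= (n ^_ h)%:R ->
  complete_kpartite k T -> (k < chi F)%N ->
  a * ex_m%:R <= #|injhoms H T|%:R + kap * m%:R ^+ h ->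
  (gen_ex n H F)%:R - kap / a * n%:R ^+ h <= (ncopies H G)%:R ->
  n%:R ^+ m * (a * ex_m%:R - 4 * kap * m%:R ^+ h) <=
    (\sum_(s : {ffun 'I_m -> 'I_n}) #|injhoms H (pull s G)|)%:R.
Proof.
move=> h a kap0 hm hn m0 n0 fm fn kT kF exT NG.
set mh := m%:R ^+ h in exT fm *; set nh := n%:R ^+ h in NG fn *.
have a0 : 0 < a by rewrite ltr0n auts_gt0.
have mh0 : 0 < mh by rewrite exprn_gt0 // ltr0n.
have nh0 : 0 < nh by rewrite exprn_gt0 // ltr0n.
have iT : #|injhoms H T|%:R <= mh.
  by have := leq_card_injhoms H T; rewrite card_ord -(ler_nat R) natrX.
set exn := gen_ex n H F in NG *.
(* Average over all blow-ups of T to n vertices. They are k-partite, hence F-free, so none has more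
   than [exn] copies of H. *)
have blowT : (n ^_ h)%:R * #|injhoms H T|%:R <= a * exn%:R * mh.
  have : (n ^_ h * (#|homs H T| * m ^ (n - h)) <= m ^ n * (#|auts H| * exn))%N.
    have := @sum_injhoms_pull _ 'I_n _ H T; rewrite !card_ord => <-.
    have <- : #|{ffun 'I_n -> 'I_m}| = (m ^ n)%N by rewrite card_ffun !card_ord.
    apply: (@leq_trans (\sum_(s : {ffun 'I_n -> 'I_m}) #|auts H| * exn)).
      apply: leq_sum => s _; rewrite card_injhoms leq_mul2l; apply/orP; right.
      apply: leq_bigmax_cond.
      by apply: kpartite_free kF; apply: complete_kpartite_pull kT.
    by rewrite sum_nat_const.
  have -> : (m ^ n = m ^ (n - h) * m ^ h)%N by rewrite -expnD subnK.
  rewrite mulnA [X in (X <= _)%N -> _]mulnC -[X in (_ <= X)%N -> _]mulnA.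
  rewrite leq_pmul2l ?expn_gt0 ?m0 // => hle.
  apply: le_trans (_ : (n ^_ h * #|homs H T|)%:R <= _).
    by rewrite natrM ler_wpM2l // ler_nat leq_card_homs.
  by rewrite /a /mh -natrX -!natrM ler_nat (leq_trans hle) // mulnC.
have homG : nh * (a * ex_m%:R - 3 * kap * mh) <= mh * #|homs H G|%:R.
  have h1 : nh * (#|injhoms H T|%:R - kap * mh) <= (n ^_ h)%:R * #|injhoms H T|%:R.
    apply: le_trans (_ : (1 - kap) * nh * #|injhoms H T|%:R <= _); last by rewrite ler_wpM2r.
    rewrite -subr_ge0.
    have -> : (1 - kap) * nh * #|injhoms H T|%:R - nh * (#|injhoms H T|%:R - kap * mh) =
      kap * nh * (mh - #|injhoms H T|%:R) by ring.
    by rewrite mulr_ge0 ?subr_ge0 // mulr_ge0 ?ltW.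
  have h2 : a * exn%:R - kap * nh <= #|homs H G|%:R.
    apply: le_trans (_ : #|injhoms H G|%:R <= _); last by rewrite ler_nat leq_card_homs.
    rewrite card_injhoms natrM -/a.
    have -> : a * exn%:R - kap * nh = a * (exn%:R - kap / a * nh) by field; rewrite gt_eqF.
    by rewrite ler_pM2l.
  have h3 : mh * (a * exn%:R - kap * nh) <= mh * #|homs H G|%:R by rewrite ler_pM2l.
  have h4 : nh * (a * ex_m%:R) <= nh * (#|injhoms H T|%:R + kap * mh) by rewrite ler_pM2l.
  lra.
have homG1 : #|homs H G|%:R <= nh.
  have : (#|homs H G| <= n ^ h)%N by rewrite -[X in (X ^ _)%N]card_ord -card_ffun max_card.
  by rewrite -(ler_nat R) natrX.
rewrite sum_injhoms_pull !card_ord !natrM natrX -/h.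
have -> : n%:R ^+ m = n%:R ^+ (m - h) * nh :> R by rewrite -exprD subnK.
set q := n%:R ^+ (m - h).
have q0 : 0 < q by rewrite exprn_gt0 // ltr0n.
rewrite [X in _ <= X]mulrA [X in _ <= X]mulrC -[X in X <= _]mulrA ler_pM2l //.
apply: le_trans (_ : (1 - kap) * mh * #|homs H G|%:R <= _); last by rewrite ler_wpM2r.
have h5 : kap * mh * #|homs H G|%:R <= kap * mh * nh by rewrite ler_pM2l // mulr_gt0.
lra.
Qed.

(** For k > 0 the empty graph is free of [complete k.+1], so the maximum runs over a nonempty set
    and is attained. *)
Lemma extremal_free k n (H : sgraph VH) : (0 < k)%N ->
  exists2 G : sgraph 'I_n, free (complete k.+1) G & ncopies H G = gen_ex n H (complete k.+1).
Proof.
move=> k0.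
have [|G GP E] := @eq_bigmax_cond _ (fun G : sgraph 'I_n => free (complete k.+1) G) (ncopies H);
  last by exists G => //; exact: esym E.
apply/card_gt0P; exists (empty_graph 'I_n); rewrite unfold_in; apply/freeP => f _ /is_homP.
case: k k0 f => // k _ f /(_ ord0 (Ordinal (isT : 1 < k.+2)%N)).
by rewrite adj_complete adj_empty => /(_ isT).
Qed.

(** Samples containing a (k+1)-clique are rare by Markov's inequality. Any other sample has at most
    [ex_m] copies, and those in [B1] fall short by d0 m^h. The average is at most 4 [kap] m^h below
    the maximum and the samples in [B0] add at most [kap] m^h, hence the factor 5. *)
Lemma few_bad_samples k m n (kap d0 : R) (H : sgraph VH) (G : sgraph 'I_n) :
  let h := #|VH| in let a := #|auts H|%:R : R in
  let ex_m := gen_ex m H (complete k.+1) in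
  let B := [set s : {ffun 'I_m -> 'I_n} | ~~ (free (complete k.+1) (pull s G) &&
     (ex_m%:R - d0 * m%:R ^+ h <= (ncopies H (pull s G))%:R :> R))] in
  0 < d0 -> (0 < m)%N -> (k.+1 <= m)%N -> 0 <= kap ->
  #|cliques G k.+1 setT|%:R <= kap / m%:R ^+ k.+1 * n%:R ^+ k.+1 ->
  n%:R ^+ m * (a * ex_m%:R - 4 * kap * m%:R ^+ h) <=
    (\sum_(s : {ffun 'I_m -> 'I_n}) #|injhoms H (pull s G)|)%:R ->
  #|B|%:R <= (kap + 5 * kap / (a * d0)) * n%:R ^+ m.
Proof.
move=> h a ex_m B d00 m0 km kap0 hC hS.
have a0 : 0 < a by rewrite ltr0n auts_gt0.
set mh := m%:R ^+ h in B hS *.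
have mh0 : 0 < mh by rewrite exprn_gt0 // ltr0n.
pose B0 := [set s : {ffun 'I_m -> 'I_n} | ~~ free (complete k.+1) (pull s G)].
pose B1 := B :\: B0.
have B0n : #|B0|%:R <= kap * n%:R ^+ m.
  have : (#|B0| <= \sum_(s : {ffun 'I_m -> 'I_n}) #|injhoms (complete k.+1) (pull s G)|)%N.
    rewrite -sum1_card big_mkcond; apply: leq_sum => s _; case: ifP => //; rewrite inE => nf.
    have: (0 < ncopies (complete k.+1) (pull s G))%N by rewrite lt0n.
    by rewrite card_injhoms muln_gt0 auts_gt0.
  rewrite sum_injhoms_pull !card_ord homs_complete -(ler_nat R) => /le_trans; apply.
  rewrite (natrM _ (m ^_ k.+1)) [X in _ * X]natrM.
  apply: le_trans (_ : m%:R ^+ k.+1 * (kap / m%:R ^+ k.+1 * n%:R ^+ k.+1 * (n ^ (m - k.+1))%:R) <= _).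
    apply: ler_pM; [by []|by rewrite mulr_ge0| |].
      by rewrite -natrX ler_nat -{2}[m]card_ord -{1}[m]card_ord -[k.+1]card_ord
        -card_inj_ffuns -card_ffun max_card.
    by rewrite ler_wpM2r.
  rewrite natrX -mulrA mulrA [m%:R ^+ _ * _]mulrC mulfVK ?gt_eqF ?exprn_gt0 ?ltr0n //.
  by rewrite -exprD addnC subnK.
have hB1 : a * d0 * #|B1|%:R <= 5 * kap * n%:R ^+ m.
  rewrite -(ler_pM2l mh0).
  have : (\sum_(s : {ffun 'I_m -> 'I_n}) #|injhoms H (pull s G)|)%:R <=
      n%:R ^+ m * (a * ex_m%:R) - a * d0 * mh * #|B1|%:R + mh * #|B0|%:R.
    have -> : n%:R ^+ m * (a * ex_m%:R) - a * d0 * mh * #|B1|%:R + mh * #|B0|%:R =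
      \sum_(s : {ffun 'I_m -> 'I_n}) (a * ex_m%:R - a * d0 * mh * (s \in B1)%:R + mh * (s \in B0)%:R).
      rewrite big_split /= sumrB sumr_const -!mulr_sumr -!natr_card card_ffun !card_ord.
      by rewrite -natrX mulr_natl.
    rewrite natr_sum; apply: ler_sum => s _; rewrite in_setD.
    case sB0 : (s \in B0) => /=.
      rewrite mulr0 subr0 mulr1 ler_wpDl ?mulr_ge0 ?(ltW a0) //.
      by have := leq_card_injhoms H (pull s G); rewrite card_ord -(ler_nat R) natrX.
    have fs : free (complete k.+1) (pull s G) by move: sB0; rewrite inE => /negbFE.
    rewrite mulr0 addr0 inE fs /= card_injhoms natrM -/a -/ex_m -ltNge.
    case: ltP => [lt|_] /=.
      have -> : a * ex_m%:R - a * d0 * mh * 1 = a * (ex_m%:R - d0 * mh) by ring.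
      by rewrite ler_pM2l // ltW.
    by rewrite mulr0 subr0 ler_pM2l // ler_nat; apply: leq_bigmax_cond.
  move=> /(le_trans hS) hs.
  have : mh * #|B0|%:R <= mh * (kap * n%:R ^+ m) by rewrite ler_pM2l.
  move: hs; set N := n%:R ^+ m; set x := #|B1|%:R; set y := #|B0|%:R => hs hy.
  have -> : mh * (a * d0 * x) = a * d0 * mh * x by ring.
  have e1 : N * (a * ex_m%:R - 4 * kap * mh) = N * (a * ex_m%:R) - 4 * (mh * (kap * N)) by ring.
  have -> : mh * (5 * kap * N) = 5 * (mh * (kap * N)) by ring.
  move: hs; rewrite e1 => hs; lra.
have sub : (#|B| <= #|B0| + #|B1|)%N.
  apply: leq_trans (leq_card_setU _ _); apply/subset_leq_card/subsetP => s sB.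
  by rewrite in_setU in_setD sB andbT orbN.
rewrite -(ler_nat R) natrD in sub; apply: (le_trans sub).
rewrite mulrDl lerD // mulrAC ler_pdivlMr ?mulr_gt0 // mulrC; exact: hB1.
Qed.

(** Stability is used twice on m vertices: once to find near the extremal graph a member of P, whose
    blow-ups are F-free, and once to show that nearly extremal samples are close to P. *)
Lemma sample_close k (P : forall n, sgraph 'I_n -> Prop) (F : sgraph VF) (H : sgraph VH) :
  (forall n (G : sgraph 'I_n), P n G -> complete_kpartite k G) ->
  (0 < k)%N -> chi F = k.+1 ->
  stable_wrt R P (complete k.+1) H ->
  forall (eps : R) (m0 : nat), 0 < eps ->
  exists m (delta : R) n0, [/\ (m0 <= m)%N, 0 < delta &
    forall n (G : sgraph 'I_n), (n0 <= n)%N -> free F G ->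
      (gen_ex n H F)%:R - delta * n%:R ^+ #|VH| <= (ncopies H G)%:R ->
      exists2 B : {set {ffun 'I_m -> 'I_n}}, #|B|%:R <= eps * n%:R ^+ m &
        forall s, s \notin B -> exists2 T, P m T &
          #|diff_pairs (pull s G) T|%:R <= eps * m%:R ^+ 2].
Proof.
move=> PK k0 chiF stab eps m0 eps0.
set h := #|VH|; pose a : R := #|auts H|%:R.
have a0 : 0 < a by rewrite ltr0n auts_gt0.
(* The factor 1/4 pays for the passage from [edge_dist] to [diff_pairs]. *)
have [|d0 [n1 [d00 st0]]] := stab (eps / 4); first by rewrite divr_gt0.
pose kap := Num.min (eps / 2) (a * d0 * eps / 10).
have kap0 : 0 < kap by rewrite lt_min !divr_gt0 ?mulr_gt0.
have kap2 : kap <= eps / 2 by rewrite ge_min lexx.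
have kap3 : kap <= a * d0 * eps / 10 by rewrite ge_min lexx orbT.
have h40 : 0 < 4 * (h%:R ^+ 2 + 1) :> R by rewrite mulr_gt0 // ltr_wpDl ?exprn_ge0.
(* This tolerance makes the loss in [card_injhoms_diff] at most [kap]; the 1 added to h^2 keeps the
   denominator positive when h = 0. *)
have [|d1 [n2 [d10 st1]]] := stab (kap / (4 * (h%:R ^+ 2 + 1))); first by rewrite divr_gt0.
have [n3 fall] := ffact_asymp h kap0.
have [m] : exists m, (maxn (maxn m0 n1) (maxn n2 (maxn n3 (maxn h k.+1))) <= m)%N.
  by eexists; exact: leqnn.
rewrite !geq_max -!andbA => /and5P[mm0 mn1 mn2 mn3 /andP[mh mk]].
have m_gt0 : (0 < m)%N by apply: leq_trans mk.
(* The sample size m is now fixed; n is taken large in terms of m, so that even m sampled vertices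
   rarely contain a (k+1)-clique. *)
have mk0 : 0 < kap / m%:R ^+ k.+1 by rewrite divr_gt0 // exprn_gt0 // ltr0n.
have [n4 few] := free_few_cliques F mk0.
exists m, (kap / a), (maxn (maxn n3 n4) (maxn h 1)); split=> //; first by rewrite divr_gt0.
move=> n G; rewrite !geq_max -!andbA => /and4P[nn3 nn4 nh n_gt0] Ffree NG.
have [E Efree EX] := extremal_free m H k0.
have [T [PT dT]] : exists T : sgraph 'I_m,
    P m T /\ (edge_dist E T)%:R <= kap / (4 * (h%:R ^+ 2 + 1)) * m%:R ^+ 2.
  by apply: st1 => //; rewrite EX lerBlDr ler_wpDr // mulr_ge0 ?exprn_ge0 // ltW.
have lowT : a * (gen_ex m H (complete k.+1))%:R <= #|injhoms H T|%:R + kap * m%:R ^+ h.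
  rewrite -EX /a -natrM -card_injhoms.
  have m2 : 0 < m%:R ^+ 2 :> R by rewrite exprn_gt0 // ltr0n.
  rewrite -(ler_pM2r m2) mulrDl.
  have := card_injhoms_diff H E T; rewrite card_ord -(ler_nat R) natrD !natrM !natrX -/h.
  move=> /le_trans; apply; rewrite lerD2l.
  have : #|diff_pairs E T|%:R <= 4 * (kap / (4 * (h%:R ^+ 2 + 1)) * m%:R ^+ 2).
    apply: le_trans (_ : (4 * edge_dist E T)%:R <= _); first by rewrite ler_nat diff_pairs_le.
    by rewrite natrM ler_pM2l.
  have -> : 4 * (kap / (4 * (h%:R ^+ 2 + 1)) * m%:R ^+ 2) =
      kap / (h%:R ^+ 2 + 1) * m%:R ^+ 2 by field; rewrite gt_eqF // ltr_wpDl ?exprn_ge0.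
  move=> dle.
  apply: le_trans (_ : h%:R ^+ 2 * (kap / (h%:R ^+ 2 + 1) * m%:R ^+ 2 * m%:R ^+ h) <= _).
    rewrite -expr2; apply: ler_wpM2l; first by rewrite exprn_ge0.
    by apply: ler_wpM2r; rewrite ?exprn_ge0.
  have -> : h%:R ^+ 2 * (kap / (h%:R ^+ 2 + 1) * m%:R ^+ 2 * m%:R ^+ h) =
    (h%:R ^+ 2 / (h%:R ^+ 2 + 1)) * (kap * m%:R ^+ h * m%:R ^+ 2) by ring.
  rewrite ler_piMl ?mulr_ge0 ?exprn_ge0 ?(ltW kap0) //.
  by rewrite ler_pdivrMr ?mul1r ?ltr_wpDl ?exprn_ge0 // lerDl.
have low := @sample_lower k m n kap F H T G _ kap0 mh nh m_gt0 n_gt0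
  (fall m mn3) (fall n nn3) (PK _ _ PT) _ lowT NG.
have /low {}low : (k < chi F)%N by rewrite chiF.
have cl : #|cliques G k.+1 setT|%:R <= kap / m%:R ^+ k.+1 * n%:R ^+ k.+1.
  by have := few 'I_n G; rewrite card_ord chiF => /(_ nn4 Ffree)/ltW.
have := few_bad_samples d00 m_gt0 mk (ltW kap0) cl low.
set B := [set s | _] => Bn; exists B.
  apply: le_trans Bn _; rewrite ler_wpM2r ?exprn_ge0 //.
  have : 5 * kap / (a * d0) <= eps / 2.
    rewrite ler_pdivrMr ?mulr_gt0 //; lra.
  by rewrite -/a; lra.
move=> s; rewrite inE negbK => /andP[fr nc].
have [T' [PT' dT']] := st0 m (pull s G) mn1 fr nc.
exists T' => //; apply: le_trans (_ : (4 * edge_dist (pull s G) T')%:R <= _).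
  by rewrite ler_nat diff_pairs_le.
by rewrite natrM; lra.
Qed.

End Sampling.

(** * From samples back to the graph *)

Section FromSamples.
Variable R : realType.

(** Good samples contribute at most 3 [eps] m^3 defects each, and the bad ones add [eps] m^3 on
    average. Dividing by the falling factorial, at least m^3/2, doubles the total. *)
Lemma few_twin_defects k m n (eps : R) (G : sgraph 'I_n) (B : {set {ffun 'I_m -> 'I_n}}) :
  0 <= eps -> (3 <= m)%N -> (0 < n)%N ->
  (1 - 1 / 2) * m%:R ^+ 3 <= (m ^_ 3)%:R :> R ->
  #|B|%:R <= eps * n%:R ^+ m ->
  (forall s, s \notin B -> exists2 T : sgraph 'I_m, complete_kpartite k T &
     #|diff_pairs (pull s G) T|%:R <= eps * m%:R ^+ 2) ->
  #|twin_defects G|%:R <= 8 * eps * n%:R ^+ 3.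
Proof.
move=> eps0 m3 n0 fm Bn close.
have m0 : 0 < m%:R :> R by rewrite ltr0n (leq_trans _ m3).
have n0R : 0 < n%:R :> R by rewrite ltr0n.
set M := m%:R ^+ 3 in fm; have M0 : 0 < M by rewrite exprn_gt0.
have up : (\sum_(s : {ffun 'I_m -> 'I_n}) #|twin_defects (pull s G)|)%:R <=
    4 * eps * M * n%:R ^+ m.
  apply: le_trans (_ : \sum_(s : {ffun 'I_m -> 'I_n}) (3 * eps * M + M * (s \in B)%:R) <= _).
    rewrite natr_sum; apply: ler_sum => s _; have [sB|sB] := boolP (s \in B).
      rewrite mulr1 ler_wpDl ?mulr_ge0 // ?(ltW M0) //.
      have : (#|twin_defects (pull s G)| <= m ^ 3)%N.
        by apply: leq_trans (max_card _) _; rewrite !card_prod card_ord !expnS expn0 muln1 mulnA.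
      by rewrite -(ler_nat R) natrX.
    rewrite mulr0 addr0; have [T kT dT] := close s sB.
    have := twin_defects_kpartite (pull s G) kT; rewrite card_ord -(ler_nat R) !natrM.
    move=> /le_trans; apply.
    have -> : 3 * eps * M = 3 * (eps * m%:R ^+ 2 * m%:R) by rewrite /M; ring.
    by rewrite ler_pM2l // ler_pM2r.
  rewrite big_split /= sumr_const -mulr_sumr -natr_card card_ffun !card_ord -[_ *+ (n ^ m)]mulr_natr natrX.
  have : M * #|B|%:R <= M * (eps * n%:R ^+ m) by rewrite ler_pM2l.
  by move: (n%:R ^+ m) #|B|%:R => x y; lra.
move: up; rewrite sum_twin_defects_pull !card_ord (natrM _ (m ^_ 3)) [X in _ * X]natrM natrX => up.
have {up} : (1 - 1 / 2) * M * (#|twin_defects G|%:R * n%:R ^+ (m - 3)) <= 4 * eps * M * n%:R ^+ m.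
  by apply: le_trans up; apply: ler_wpM2r => //; rewrite mulr_ge0 // exprn_ge0.
have -> : n%:R ^+ m = n%:R ^+ 3 * n%:R ^+ (m - 3) :> R by rewrite -exprD subnKC.
have q0 : 0 < n%:R ^+ (m - 3) :> R by rewrite exprn_gt0.
rewrite [X in X <= _]mulrA [X in _ <= X]mulrA ler_pM2r // => h.
rewrite -(ler_pM2l M0); lra.
Qed.

Lemma many_edges m n (eps c : R) (G : sgraph 'I_n) (B : {set {ffun 'I_m -> 'I_n}}) :
  0 <= c -> c <= 1 -> (2 <= m)%N -> (0 < n)%N ->
  #|B|%:R <= eps * n%:R ^+ m ->
  (forall s, s \notin B ->
    c * m%:R ^+ 2 <= #|[set p : 'I_m * 'I_m | adj (pull s G) p.1 p.2]|%:R) ->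
  (c - eps) * n%:R ^+ 2 <= #|[set p : 'I_n * 'I_n | adj G p.1 p.2]|%:R.
Proof.
move=> c0 c1 m2 n0 Bn close.
have m0 : 0 < m%:R :> R by rewrite ltr0n (leq_trans _ m2).
have n0R : 0 < n%:R :> R by rewrite ltr0n.
set M := m%:R ^+ 2 in close; have M0 : 0 < M by rewrite exprn_gt0.
have : (c - eps) * M * n%:R ^+ m <=
    (\sum_(s : {ffun 'I_m -> 'I_n}) #|[set p : 'I_m * 'I_m | adj (pull s G) p.1 p.2]|)%:R.
  apply: le_trans (_ : \sum_(s : {ffun 'I_m -> 'I_n}) (c * M - M * (s \in B)%:R) <= _).
    rewrite sumrB sumr_const -mulr_sumr -natr_card card_ffun !card_ord -[_ *+ (n ^ m)]mulr_natr natrX.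
    have : M * #|B|%:R <= M * (eps * n%:R ^+ m) by rewrite ler_pM2l.
    by move: (n%:R ^+ m) #|B|%:R => x y; lra.
  rewrite natr_sum; apply: ler_sum => s _; have [sB|sB] := boolP (s \in B); last first.
    by rewrite mulr0 subr0; exact: close.
  rewrite mulr1; apply: le_trans (_ : 0 <= _) => //.
  by rewrite subr_le0 ger_pMl.
rewrite sum_adj_pull !card_ord (natrM _ (m ^_ 2)) (natrM _ #|_|) natrX.
set e := #|_|%:R; move=> h.
have {h} : (c - eps) * M * n%:R ^+ m <= M * (e * n%:R ^+ (m - 2)).
  apply: le_trans h _; apply: ler_wpM2r; first by rewrite mulr_ge0 // exprn_ge0.
  by rewrite /M -natrX ler_nat ffactnS ffactn1 -mulnn leq_mul ?leq_pred.
have -> : n%:R ^+ m = n%:R ^+ 2 * n%:R ^+ (m - 2) :> R by rewrite -exprD subnKC.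
have q0 : 0 < n%:R ^+ (m - 2) :> R by rewrite exprn_gt0.
rewrite [X in X <= _]mulrA [X in _ <= X]mulrA ler_pM2r // => h.
by rewrite -(ler_pM2l M0) mulrCA mulrA.
Qed.

End FromSamples.

(** * Balancing the parts *)

Section Balance.

(** Canonical part sizes of a Turan graph. Passing from n to n+1 shifts the summands by one place;
    the lost term n %/ k returns as (n + k) %/ k, which is one larger. *)
Lemma sum_floor k n : (0 < k)%N -> (\sum_(j < k) (n + j) %/ k = n)%N.
Proof.
move=> k0; elim: n => [|n IH].
  by rewrite big1 // => j _; rewrite add0n divn_small.
case: k k0 IH => // k _ IH.
rewrite big_ord_recr /= addSnnS divnDr // divnn /= addn1 addnS; congr _.+1.
rewrite -[RHS]IH big_ord_recl /= addn0 addnC; congr (_ + _)%N.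
by apply: eq_bigr => j _; rewrite /bump /= addSnnS.
Qed.

(** Vertices move one at a time from an overfull class to a deficient one. Each move lowers by one
    the total excess, which truncated subtraction measures. *)
Lemma recolor (T : finType) k (c : T -> 'I_k) (b : 'I_k -> nat) :
  (\sum_j b j = #|T|)%N ->
  exists2 c' : T -> 'I_k, forall j, #|[set x | c' x == j]| = b j &
    (#|[set x | c x != c' x]| <= \sum_j (#|[set x | c x == j]| - b j))%N.
Proof.
move=> bT; have [N] := ubnP (\sum_j (#|[set x | c x == j]| - b j))%N.
elim: N c => // N IH c.
have sumc (d : T -> 'I_k) : (\sum_j #|[set x | d x == j]| = #|T|)%N.
  rewrite -[RHS]sum1_card (partition_big d xpredT) //=.
  by apply: eq_bigr => j _; rewrite sum1_card; apply: eq_card => x; rewrite inE.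
rewrite ltnS => cN.
have [/forallP le|/forallPn[j]] := boolP [forall j, #|[set x | c x == j]| <= b j]%N.
  exists c; last by rewrite (_ : [set _ | _] = set0) ?cards0 //; apply/setP => x; rewrite !inE eqxx.
  move=> j; have := sumc c; rewrite -bT => /eqP.
  have -> : (\sum_j #|[set x | c x == j]| == \sum_j b j)%N = [forall j, #|[set x | c x == j]| == b j].
    by rewrite (leqif_sum (fun j _ => leqif_eq (le j))).
  by move/forallP/(_ j)/eqP.
rewrite -ltnNge => jb.
have [l lb] : exists l, (#|[set x | c x == l]| < b l)%N.
  apply/existsP; apply: contraLR jb; rewrite negb_exists => /forallP ge; rewrite -leqNgt.
  have := sumc c; rewrite -bT => /esym/eqP.
  have -> : (\sum_j b j == \sum_j #|[set x | c x == j]|)%N = [forall j, b j == #|[set x | c x == j]|].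
    rewrite (leqif_sum (fun j _ => leqif_eq _)) // => i _.
    by rewrite leqNgt ge.
  by move/forallP/(_ j)/eqP => ->.
have jl : j != l by apply/eqP => E; move: lb; rewrite -E ltnNge ltnW.
have [x0] : exists x, x \in [set x | c x == j].
  by apply/card_gt0P; apply: leq_trans jb.
rewrite inE => /eqP cx0.
pose c1 x := if x == x0 then l else c x.
have c1j : [set x | c1 x == j] = [set x | c x == j] :\ x0.
  apply/setP => x; rewrite !inE /c1; case: (x =P x0) => //= _.
  by rewrite eq_sym (negbTE jl).
have c1l : [set x | c1 x == l] = x0 |: [set x | c x == l].
  by apply/setP => x; rewrite !inE /c1; case: (x =P x0) => //= _; rewrite eqxx.
have c1o i : i != j -> i != l -> [set x | c1 x == i] = [set x | c x == i].
  move=> ij il; apply/setP => x; rewrite !inE /c1; case: (x =P x0) => //= ->.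
  by rewrite cx0 ![_ == i]eq_sym (negbTE ij) (negbTE il).
have cardj : #|[set x | c x == j]| = #|[set x | c1 x == j]|.+1.
  by rewrite c1j (cardsD1 x0 [set x | c x == j]) inE cx0 eqxx.
have cardl : #|[set x | c1 x == l]| = #|[set x | c x == l]|.+1.
  by rewrite c1l cardsU1 inE cx0 (negbTE jl).
have sum1 : (\sum_j (#|[set x | c x == j]| - b j) =
    (\sum_j (#|[set x | c1 x == j]| - b j)).+1)%N.
  rewrite (bigD1 j) //= [in RHS](bigD1 j) //= cardj subSn; last by rewrite -ltnS -cardj.
  rewrite addSn; congr (_ + _).+1; apply: eq_bigr => i ij.
  have [->|il] := eqVneq i l; last by rewrite c1o.
  rewrite cardl; apply/eqP; rewrite eq_sym.
  by rewrite (eqP (ltnW lb : _ - _ == 0)%N).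
have [|c' c'b c'd] := IH c1; first by rewrite -ltnS -sum1 ltnS.
exists c' => //; rewrite sum1.
apply: leq_trans (_ : #|x0 |: [set x | c1 x != c' x]| <= _)%N.
  apply/subset_leq_card/subsetP => x; rewrite !inE /c1.
  by case: (x =P x0).
by apply: leq_trans (leq_card_setU _ _) _; rewrite cards1 add1n ltnS.
Qed.

Lemma diff_partite (T : finType) k (c c' : T -> 'I_k) :
  (#|diff_pairs (partite c) (partite c')| <= 2 * (#|T| * #|[set x | c x != c' x]|))%N.
Proof.
set D := [set x | _].
apply: leq_trans (_ : #|setX D [set: T] :|: setX [set: T] D| <= _)%N.
  apply/subset_leq_card/subsetP => -[x y]; rewrite !inE /= !adj_partite andbT.
  by case: (c x =P c' x) => //= ->; case: (c y =P c' y) => //= ->; rewrite eqxx.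
apply: leq_trans (leq_card_setU _ _) _.
by rewrite !cardsX cardsT mulnC addnn mul2n.
Qed.

Lemma card_adj_partite (T : finType) k (c : T -> 'I_k) :
  (#|[set p : T * T | adj (partite c) p.1 p.2]| + \sum_j #|[set x | c x == j]| ^ 2 = #|T| ^ 2)%N.
Proof.
rewrite -mulnn -card_prod -(cardC [set p : T * T | adj (partite c) p.1 p.2]); congr (_ + _)%N.
rewrite -[RHS]sum1_card (partition_big (fun p : T * T => c p.1) xpredT) //=.
apply: eq_bigr => j _; rewrite -mulnn -cardsX -[LHS]sum1_card; apply: eq_bigl => -[x y].
rewrite !inE /= adj_partite negbK; case: eqP => [<-|] /=; last by rewrite andbF.
by rewrite andbT eq_sym.
Qed.

Lemma turan_class_size k n (j : 'I_k) :
  ((n + j) %/ k = n %/ k \/ (n + j) %/ k = (n + k.-1) %/ k)%N.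
Proof.
have k0 : (0 < k)%N by apply: leq_trans (ltn_ord j).
have h1 : (n %/ k <= (n + j) %/ k)%N by rewrite leq_div2r // leq_addr.
have h2 : ((n + j) %/ k <= (n + k.-1) %/ k)%N.
  by rewrite leq_div2r // leq_add2l -ltnS prednK.
have h3 : ((n + k.-1) %/ k <= (n %/ k).+1)%N.
  have -> : ((n %/ k).+1 = (n + k) %/ k)%N by rewrite divnDr // divnn k0 addn1.
  by rewrite leq_div2r // leq_add2l leq_pred.
have [e|ne] := eqVneq ((n + j) %/ k)%N (n %/ k)%N; [by left|right].
apply/eqP; rewrite eqn_leq h2 (leq_trans h3) //.
by rewrite ltn_neqAle eq_sym ne.
Qed.

Lemma turan_card_adj (R : realFieldType) k m (T : sgraph 'I_m) : (0 < k)%N -> is_turan k T ->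
  (1 - k%:R^-1) * m%:R ^+ 2 - m%:R <= #|[set p : 'I_m * 'I_m | adj T p.1 p.2]|%:R :> R.
Proof.
move=> k0 [c [cT sizes]].
have k0R : 0 < k%:R :> R by rewrite ltr0n.
have := card_adj_partite c; rewrite card_ord.
have -> : [set p : 'I_m * 'I_m | adj (partite c) p.1 p.2] = [set p | adj T p.1 p.2].
  by apply/setP => p; rewrite !inE adj_partite cT.
move/(congr1 (fun x => x%:R : R)); rewrite natrD natrX => E.
have sz j : #|[set x | c x == j]|%:R <= m%:R / k%:R + 1 :> R.
  have : (#|[set x | c x == j]| <= (m + k.-1) %/ k)%N.
    by case: (sizes j) => ->; rewrite card_ord // leq_div2r // leq_addr.
  rewrite -(ler_nat R) => /le_trans; apply.
  rewrite -(ler_pM2r k0R) mulrDl mulfVK ?gt_eqF // mul1r -natrM -natrD ler_nat.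
  by apply: leq_trans (leq_divM _ _) _; rewrite leq_add2l leq_pred.
have : (\sum_j #|[set x | c x == j]| ^ 2)%:R <= m%:R * (m%:R / k%:R + 1) :> R.
  have mE : (\sum_j #|[set x | c x == j]| = m)%N.
    rewrite -[RHS]card_ord -[RHS]sum1_card (partition_big c xpredT) //=.
    by apply: eq_bigr => j _; rewrite sum1_card; apply: eq_card => x; rewrite inE.
  apply: le_trans (_ : (\sum_j #|[set x | c x == j]|)%:R * (m%:R / k%:R + 1) <= _); last by rewrite mE.
  rewrite !natr_sum mulr_suml; apply: ler_sum => j _.
  by rewrite natrX expr2 ler_wpM2l.
have -> : (1 - k%:R^-1) * m%:R ^+ 2 - m%:R = m%:R ^+ 2 - m%:R * (m%:R / k%:R + 1) :> R by ring.
lra.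
Qed.

(** Many edges force the sum of squared part sizes close to its minimum n^2/k, so by the variance
    identity no part exceeds n/k by more than [nu] n. Recolouring then moves at most 2 [nu] n
    vertices per class, the rounding error 1 being absorbed by [nu] n. *)
Lemma balance (R : realType) k (nu : R) (T : finType) (G : sgraph T) (c : T -> 'I_k) :
  0 < nu -> (0 < k)%N -> 1 <= nu * #|T|%:R ->
  (1 - k%:R^-1 - nu ^+ 2 / 2) * #|T|%:R ^+ 2 <= #|[set p : T * T | adj G p.1 p.2]|%:R ->
  #|diff_pairs G (partite c)|%:R <= nu ^+ 2 / 2 * #|T|%:R ^+ 2 ->
  exists2 G' : sgraph T, is_turan k G' &
    #|diff_pairs G G'|%:R <= (nu ^+ 2 / 2 + 4 * k%:R * nu) * #|T|%:R ^+ 2.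
Proof.
move=> nu0 k0 nT eG dG; set n := #|T|%:R in nT eG dG *.
have k0R : 0 < k%:R :> R by rewrite ltr0n.
have n0 : 0 < n by rewrite -(pmulr_rgt0 _ nu0) (lt_le_trans _ nT).
pose a j : R := #|[set x | c x == j]|%:R.
have suma : \sum_j a j = n.
  rewrite -natr_sum /n; congr (_%:R); rewrite -[RHS]sum1_card (partition_big c xpredT) //=.
  by apply: eq_bigr => j _; rewrite sum1_card; apply: eq_card => x; rewrite inE.
have suma2 : \sum_j a j ^+ 2 <= (k%:R^-1 + nu ^+ 2) * n ^+ 2.
  have := card_adj_partite c => /(congr1 (fun x => x%:R : R)).
  rewrite natrD natrX natr_sum -/n (eq_bigr (fun j => a j ^+ 2)) => [E|j _]; last by rewrite natrX.
  have : (#|[set p : T * T | adj G p.1 p.2]| <=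
      #|[set p : T * T | adj (partite c) p.1 p.2]| + #|diff_pairs G (partite c)|)%N.
    apply: leq_trans (leq_card_setU _ _); apply/subset_leq_card/subsetP => p.
    by rewrite !inE => ->; case: (adj (partite c) _ _).
  rewrite -(ler_nat R) natrD; lra.
have dev : \sum_j (a j - n / k%:R) ^+ 2 <= (nu * n) ^+ 2.
  have -> : \sum_j (a j - n / k%:R) ^+ 2 = \sum_j a j ^+ 2 - n ^+ 2 / k%:R.
    under eq_bigr => j _ do rewrite sqrrB.
    rewrite big_split sumrB /= sumr_const card_ord sumrMnl -mulr_suml suma.
    by rewrite -[_ ^+ 2 *+ k]mulr_natr; field; rewrite gt_eqF.
  have -> : (nu * n) ^+ 2 = (k%:R^-1 + nu ^+ 2) * n ^+ 2 - n ^+ 2 / k%:R by ring.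
  by rewrite lerD2r.
have aj j : a j <= n / k%:R + nu * n.
  rewrite -lerBlDl; apply: le_trans (ler_norm _) _.
  rewrite -(@ler_pXn2r _ 2) ?nnegrE // ?mulr_ge0 ?(ltW nu0) ?(ltW n0) //.
  rewrite real_normK ?num_real //; apply: le_trans dev.
  by rewrite (bigD1 j) //= lerDl sumr_ge0 // => i _; rewrite sqr_ge0.
have [c' c'b c'd] := recolor c (sum_floor #|T| k0).
exists (partite c').
  exists c'; split=> [x y|j]; first exact: adj_partite.
  by rewrite c'b; exact: turan_class_size.
have c'd' : #|[set x | c x != c' x]|%:R <= 2 * k%:R * (nu * n).
  apply: le_trans (_ : (\sum_j (#|[set x | c x == j]| - (#|T| + j) %/ k))%:R <= _).
    by rewrite ler_nat.
  rewrite natr_sum; apply: le_trans (_ : \sum_(j < k) (2 * (nu * n)) <= _); last first.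
    by rewrite sumr_const card_ord -[leLHS]mulr_natl mulrCA mulrA.
  apply: ler_sum => j _.
  have [le|/ltnW le] := leqP (#|[set x | c x == j]|) ((#|T| + j) %/ k)%N.
    by rewrite (eqP (le : _ - _ == 0)%N) mulr_ge0 // mulr_ge0 // ltW.
  rewrite natrB // -/(a j).
  have : n / k%:R <= ((#|T| + j) %/ k)%:R + 1.
    rewrite ler_pdivrMr // natr1 -natrM ler_nat.
    by apply: leq_trans (ltnW (ltn_ceil _ k0)); rewrite leq_addr.
  by have := aj j; lra.
apply: le_trans (_ : #|diff_pairs G (partite c)|%:R + #|diff_pairs (partite c) (partite c')|%:R <= _).
  rewrite -natrD ler_nat; apply: leq_trans (leq_card_setU _ _).
  apply/subset_leq_card/subsetP => p; rewrite !inE.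
  by case: (adj G _ _); case: (adj _ _ _); case: (adj _ _ _).
have : #|diff_pairs (partite c) (partite c')|%:R <= 2 * (n * (2 * k%:R * (nu * n))).
  apply: le_trans (_ : (2 * (#|T| * #|[set x | c x != c' x]|))%:R <= _).
    by rewrite ler_nat diff_partite.
  by rewrite !natrM ler_pM2l // ler_pM2l.
have -> : 2 * (n * (2 * k%:R * (nu * n))) = 4 * k%:R * nu * n ^+ 2 by ring.
lra.
Qed.

End Balance.

(** * Stability *)

Section Stability.
Variable R : realType.
Variables VF VH : finType.

(** The 1-cliques of a graph are all its vertices, so [free_few_cliques] with constant 1 is violated
    by every large F-free graph. *)
Lemma free_chi1_bounded (F : sgraph VF) : chi F = 1%N ->
  exists n0 : nat, forall n (G : sgraph 'I_n), (n0 <= n)%N -> ~ free F G.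
Proof.
move=> chiF; have [n0 few] := free_few_cliques F (@ltr01 R).
exists n0 => n G n0n Ffree; have := few 'I_n G; rewrite card_ord chiF => /(_ n0n Ffree).
rewrite -homs_complete mul1r expr1 ltr_nat ltnNge => /negP; apply.
rewrite -[X in (X <= _)%N](card_ord n) -[X in (X <= _)%N]expn1 -[X in (_ ^ X <= _)%N](card_ord 1) -card_ffun.
apply/subset_leq_card/subsetP => f _; rewrite inE; apply/is_homP => x y.
by rewrite adj_complete !ord1.
Qed.

(** Close samples have few twin defects, and F-freeness gives few (k+1)-cliques; [near_kpartite]
    combines the two. The samples are returned as well, for estimating the edge density. *)
Lemma close_to_partite k (P : forall n, sgraph 'I_n -> Prop) (F : sgraph VF) (H : sgraph VH) :
  (forall n (G : sgraph 'I_n), P n G -> complete_kpartite k G) ->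
  (0 < k)%N -> chi F = k.+1 ->
  stable_wrt R P (complete k.+1) H ->
  forall (eps : R) (m0 : nat), 0 < eps ->
  exists m (delta : R) n0, [/\ (m0 <= m)%N, 0 < delta &
    forall n (G : sgraph 'I_n), (n0 <= n)%N -> free F G ->
      (gen_ex n H F)%:R - delta * n%:R ^+ #|VH| <= (ncopies H G)%:R ->
      (exists c : 'I_n -> 'I_k, #|diff_pairs G (partite c)|%:R <= eps * n%:R ^+ 2) /\
      exists2 B : {set {ffun 'I_m -> 'I_n}}, #|B|%:R <= eps * n%:R ^+ m &
        forall s, s \notin B -> exists2 T, P m T &
          #|diff_pairs (pull s G) T|%:R <= eps * m%:R ^+ 2].
Proof.
move=> PK k0 chiF stab eps m0 eps0.
have [d d0 near] := @near_kpartite R k eps eps0.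
pose e := Num.min eps (d / 8).
have e0 : 0 < e by rewrite lt_min eps0 divr_gt0.
have [n1 ff] := @ffact_asymp R 3 (1 / 2) (divr_gt0 ltr01 (ltr0n _ 2)).
have [m [delta [n2 [+ delta0 close]]]] :=
  sample_close PK k0 chiF stab (maxn m0 (maxn n1 3)) e0.
rewrite !geq_max => /and3P[m0m n1m m3].
have [n3 few] := free_few_cliques F d0.
exists m, delta, (maxn 1 (maxn n2 n3)); split=> // n G.
rewrite !geq_max => /and3P[n_gt0 n2n n3n] Ffree NG.
have [B Bn Bclose] := close n G n2n Ffree NG; split.
  have [|||c dc] := near 'I_n G; rewrite ?card_ord //.
  - apply: le_trans (_ : 8 * e * n%:R ^+ 3 <= _).
      apply: (@few_twin_defects R k m n e G B) => //; [exact: ltW|exact: ff|].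
      by move=> s /Bclose[T /PK kT dT]; exists T.
    rewrite ler_wpM2r ?exprn_ge0 //.
    have : e <= d / 8 by rewrite ge_min lexx orbT.
    lra.
  - by have := few 'I_n G; rewrite card_ord chiF => /(_ n3n Ffree)/ltW.
  - by exists c; move: dc; rewrite card_ord.
have ee : e <= eps by rewrite ge_min lexx.
exists B; first by apply: le_trans Bn _; rewrite ler_wpM2r ?exprn_ge0.
move=> s /Bclose[T PT dT]; exists T => //; apply: le_trans dT _.
by rewrite ler_wpM2r ?exprn_ge0.
Qed.

Lemma weakly_stable k (F : sgraph VF) (H : sgraph VH) : (0 < k)%N -> chi F = k.+1 ->
  stable_wrt R (fun n => @complete_kpartite 'I_n k) (complete k.+1) H ->
  stable_wrt R (fun n => @complete_kpartite 'I_n k) F H.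
Proof.
move=> k0 chiF stab eps eps0.
have [m [delta [n0 [_ delta0 close]]]] := close_to_partite (fun _ _ => id) k0 chiF stab 0 eps0.
exists delta, n0; split=> // n G n0n Ffree NG.
have [[c dc] _] := close n G n0n Ffree NG.
exists (partite c); split; first by exists c; exact: adj_partite.
by apply: le_trans dc; rewrite ler_nat edge_dist_le.
Qed.

Lemma turan_kpartite k (T : finType) (G : sgraph T) : is_turan k G -> complete_kpartite k G.
Proof. by case=> c [cG _]; exists c. Qed.

(** Samples near Turan graphs give G an edge density of nearly 1 - 1/k, which is what [balance] asks
    of the partition already found. *)
Lemma strongly_stable k (F : sgraph VF) (H : sgraph VH) : (0 < k)%N -> chi F = k.+1 ->
  stable_wrt R (fun n => @is_turan 'I_n k) (complete k.+1) H ->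
  stable_wrt R (fun n => @is_turan 'I_n k) F H.
Proof.
move=> k0 chiF stab eps eps0.
have k0R : 0 < k%:R :> R by rewrite ltr0n.
have k41 : 0 < 4 * k%:R + 1 :> R by rewrite ltr_wpDl ?mulr_ge0.
(* As [nu] is at most 1, the error nu^2/2 + 4k nu of [balance] is at most (4k + 1) nu, hence at most
   [eps]. *)
pose nu := Num.min 1 (eps / (4 * k%:R + 1)).
have nu0 : 0 < nu by rewrite lt_min ltr01 divr_gt0.
have nu1 : nu <= 1 by rewrite ge_min lexx.
have nu2 : nu * (4 * k%:R + 1) <= eps by rewrite -ler_pdivlMr // ge_min lexx orbT.
have nunu : 0 < nu ^+ 2 by rewrite exprn_gt0.
(* The density loses 1/m to rounding, [e] to the distance from a Turan graph and [e] to bad samples: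
   at most 3e, which is below nu^2/2. *)
pose e := nu ^+ 2 / 8; have e0 : 0 < e by rewrite divr_gt0.
have [m1 hm1] := archi_nat e^-1.
have [n1 hn1] := archi_nat nu^-1.
have [m [delta [n0 [+ delta0 close]]]] :=
  close_to_partite (fun n => @turan_kpartite k 'I_n) k0 chiF stab (maxn m1 2) e0.
rewrite geq_max => /andP[m1m m2].
have m0R : 0 < m%:R :> R by rewrite ltr0n (leq_trans _ m2).
have me : m%:R^-1 <= e.
  rewrite -[e]invrK lef_pV2 ?posrE ?invr_gt0 //.
  by apply: (le_trans (ltW hm1)); rewrite ler_nat.
exists delta, (maxn n0 (maxn 1 n1)); split=> // n G.
rewrite !geq_max => /and3P[n0n n_gt0 n1n] Ffree NG.
have [[c dc] [B Bn Bclose]] := close n G n0n Ffree NG.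
(* Truncated at 0 because [many_edges] takes a nonnegative density; for k = 1 the other term is
   negative. *)
pose c0 : R := Num.max 0 (1 - k%:R^-1 - m%:R^-1 - e).
have c0E : c0 = 0 \/ c0 = 1 - k%:R^-1 - m%:R^-1 - e by rewrite /c0; case: leP; auto.
have k1 : 0 < k%:R^-1 :> R by rewrite invr_gt0.
have m1' : 0 < m%:R^-1 :> R by rewrite invr_gt0.
have eG : (c0 - e) * n%:R ^+ 2 <= #|[set p : 'I_n * 'I_n | adj G p.1 p.2]|%:R.
  apply: many_edges m2 n_gt0 Bn _; rewrite ?le_max ?lexx //.
    by rewrite ge_max ler01 /=; lra.
  move=> s /Bclose[T tT dT]; case: c0E => ->; first by rewrite mul0r.
  have tE := @turan_card_adj R k m T k0 tT.
  have : (#|[set p : 'I_m * 'I_m | adj T p.1 p.2]| <=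
      #|[set p : 'I_m * 'I_m | adj (pull s G) p.1 p.2]| + #|diff_pairs (pull s G) T|)%N.
    apply: leq_trans (leq_card_setU _ _); apply/subset_leq_card/subsetP => p.
    by rewrite !inE => ->; case: (adj (pull s G) _ _).
  rewrite -(ler_nat R) natrD => tG.
  have -> : (1 - k%:R^-1 - m%:R^-1 - e) * m%:R ^+ 2 =
    (1 - k%:R^-1) * m%:R ^+ 2 - m%:R - e * m%:R ^+ 2 by field; rewrite !gt_eqF.
  lra.
have c0e : 1 - k%:R^-1 - nu ^+ 2 / 2 <= c0 - e.
  have : 1 - k%:R^-1 - m%:R^-1 - e <= c0 by rewrite le_max lexx orbT.
  by move: me; rewrite /e; lra.
have [| | |G' tG' dG'] := @balance R k nu 'I_n G c nu0 k0; rewrite ?card_ord.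
- rewrite mulrC -ler_pdivrMr // div1r; apply: (le_trans (ltW hn1)).
  by rewrite ler_nat.
- by apply: le_trans eG; rewrite ler_wpM2r ?exprn_ge0.
- by apply: le_trans dc _; rewrite ler_wpM2r ?exprn_ge0 // /e; lra.
exists G'; split=> //; apply: le_trans (_ : #|diff_pairs G G'|%:R <= _).
  by rewrite ler_nat edge_dist_le.
apply: le_trans dG' _; rewrite card_ord ler_wpM2r ?exprn_ge0 //.
have : nu ^+ 2 <= nu by rewrite expr2 ger_pMl.
lra.
Qed.

End Stability.

Theorem proposition1p3 (R : realType) (VF VH : finType)
    (F : sgraph VF) (H : sgraph VH) (k : nat)
    (chiF : chi F = k.+1) (chiH : (chi H < chi F)%N) :
  (weakly_asymp_turan_good R F H ->
   weakly_turan_stable R (complete k.+1) H ->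
   weakly_turan_stable R F H)
  /\
  (asymp_turan_good R F H ->
   turan_stable R (complete k.+1) H ->
   turan_stable R F H).
Proof.
rewrite /weakly_turan_stable /turan_stable chi_complete chiF /=.
(* For k = 0 no large graph is F-free, so stability holds vacuously beyond [n0], with an arbitrary
   delta. *)
have [k0|k0] := posnP k; last by split=> _; [exact: weakly_stable|exact: strongly_stable].
rewrite k0 in chiF *.
have [n0 bounded] := free_chi1_bounded R chiF.
by split=> _ _ eps _; exists 1, n0; split=> // n G n0n /(bounded n G n0n).
Qed.
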